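(* Let $\beta\ge 1$ and $\gamma\ge 1$. Suppose there is a polynomial time algorithm $A$ which, for every undirected graph $G$ with positive edge weights and every integer $k$, returns an induced subgraph of $G$ with at most $\beta k$ vertices and density at least $\mathrm{dam}(G,k)/\gamma$. Then there is a polynomial time algorithm which, for every undirected graph $G$ on $n$ vertices with positive edge weights and every integer $k$ with $1\le k\le n$, returns an induced subgraph of $G$ with exactly $k$ vertices and density at least $\mathrm{dk}(G,k)/\bigl(4(\gamma^2+\gamma\beta)\bigr)$; i.e., a polynomial time $4(\gamma^2+\gamma\beta)$-approximation algorithm for the densest $k$-subgraph problem.
   Context: For an induced subgraph $H$ of $G$, $W(H)$ is the sum of the weights of the edges of $H$, $|H|$ is its number of vertices, and its density is $d(H)=W(H)/|H|$. $\mathrm{dam}(G,k)$ denotes the maximum density of an induced subgraph of $G$ with at most $k$ vertices, and $\mathrm{dk}(G,k)$ denotes the maximum density of an induced subgraph of $G$ with exactly $k$ vertices. *)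

(* Defs.v *)
From HB Require Import structures.
From mathcomp Require Import all_boot all_order all_algebra.
From mathcomp Require Import reals.

Set Implicit Arguments.
Unset Strict Implicit.
Unset Printing Implicit Defensive.

Import Order.TTheory GRing.Theory Num.Theory.

(* Edge weights are rational so that a weighted graph is a finite input. The
   values of [weight] outside [edge] are irrelevant: no definition below
   reads them. *)
Record wgraph := WGraph {
  nverts : nat;
  edge : rel 'I_nverts;
  weight : 'I_nverts -> 'I_nverts -> rat;
  edge_sym : symmetric edge;
  edge_irr : irreflexive edge;
  weight_sym : forall i j, edge i j -> weight i j = weight j i;
  weight_gt0 : forall i j, edge i j -> (0 < weight i j)%R
}.

Notation vertex G := 'I_(nverts G).

(* An induced subgraph is represented by its vertex set. *)
Definition total_weight (G : wgraph) (S : {set vertex G}) : rat :=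
  (\sum_(i in S) \sum_(j in S | edge i j && (i < j)%N) weight i j)%R.

Definition density (G : wgraph) (S : {set vertex G}) : rat :=
  (total_weight S / #|S|%:R)%R.

(* Densities are nonnegative, so starting the maxima at 0 has no effect as
   soon as some S is eligible (1 <= nverts G and 1 <= k for [dam],
   1 <= k <= nverts G for [dk]). *)
Definition dam (G : wgraph) (k : nat) : rat :=
  \big[Num.max/0%R]_(S : {set vertex G} | (S != set0) && (#|S| <= k))
    density S.

Definition dk (G : wgraph) (k : nat) : rat :=
  \big[Num.max/0%R]_(S : {set vertex G} | #|S| == k) density S.

(* Model of computation: while-programs over binary trees (the WHILE language
   of N. D. Jones, "Computability and Complexity from a Programming
   Perspective"). An assignment is charged the size of the tree it stores, so
   the total size of the store never exceeds the size of the input plus a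
   constant plus the time used so far, and a shared subtree is paid for at each
   copy; hence time in this model and time on a Turing machine are
   polynomially related. *)
Inductive tree := Nil | Cons of tree & tree.

Fixpoint tree_size (u : tree) : nat :=
  if u is Cons u1 u2 then (tree_size u1 + tree_size u2).+1 else 1.

Definition hd (u : tree) : tree := if u is Cons u1 _ then u1 else Nil.
Definition tl (u : tree) : tree := if u is Cons _ u2 then u2 else Nil.

Inductive expr :=
  | EVar of nat
  | ENil
  | ECons of expr & expr
  | EHd of expr
  | ETl of expr.

Inductive cmd :=
  | Skip
  | Assign of nat & expr
  | Seq of cmd & cmd
  | If of nat & cmd & cmd
  | While of nat & cmd.

Definition store := nat -> tree.

Definition update (s : store) (x : nat) (u : tree) : store :=
  fun y => if y == x then u else s y.

Fixpoint eval (s : store) (e : expr) : tree :=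
  match e with
  | EVar x => s x
  | ENil => Nil
  | ECons e1 e2 => Cons (eval s e1) (eval s e2)
  | EHd e1 => hd (eval s e1)
  | ETl e1 => tl (eval s e1)
  end.

(* A test on a variable succeeds iff its value is not [Nil]. *)
Definition truthy (u : tree) : bool := if u is Nil then false else true.

(* [exec c s t s']: started in store s, c halts after time t in store s'. *)
Inductive exec : cmd -> store -> nat -> store -> Prop :=
  | ExecSkip s : exec Skip s 1 s
  | ExecAssign x e s :
      exec (Assign x e) s (tree_size (eval s e)).+1 (update s x (eval s e))
  | ExecSeq c1 c2 s t1 s1 t2 s2 :
      exec c1 s t1 s1 -> exec c2 s1 t2 s2 ->
      exec (Seq c1 c2) s (t1 + t2) s2
  | ExecIfTrue x c1 c2 s t s' :
      truthy (s x) -> exec c1 s t s' -> exec (If x c1 c2) s t.+1 s'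
  | ExecIfFalse x c1 c2 s t s' :
      ~~ truthy (s x) -> exec c2 s t s' -> exec (If x c1 c2) s t.+1 s'
  | ExecWhileFalse x c s :
      ~~ truthy (s x) -> exec (While x c) s 1 s
  | ExecWhileTrue x c s t1 s1 t2 s2 :
      truthy (s x) -> exec c s t1 s1 -> exec (While x c) s1 t2 s2 ->
      exec (While x c) s (t1 + t2).+1 s2.

(* Input and output are in variable 0; all other variables start at [Nil]. *)
Definition init (u : tree) : store := update (fun=> Nil) 0 u.

Definition enc_seq (s : seq tree) : tree := foldr Cons Nil s.

Definition enc_bool (b : bool) : tree := if b then Cons Nil Nil else Nil.

(* Numbers are written in binary, least significant bit first; zero is the
   empty list of bits. *)
Fixpoint bits_pos (p : BinNums.positive) : seq bool :=
  match p with
  | BinNums.xH => [:: true]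
  | BinNums.xO p' => false :: bits_pos p'
  | BinNums.xI p' => true :: bits_pos p'
  end.

Definition bits (n : nat) : seq bool :=
  if bin_of_nat n is BinNums.Npos p then bits_pos p else [::].

Definition enc_nat (n : nat) : tree := enc_seq (map enc_bool (bits n)).

(* Only applied to positive rationals: the sign is dropped. *)
Definition enc_rat (q : rat) : tree :=
  Cons (enc_nat (absz (numq q))) (enc_nat (absz (denq q))).

(* Adjacency matrix, with [Nil] for non-edges; [enc_rat] is never [Nil]. *)
Definition enc_graph (G : wgraph) : tree :=
  enc_seq [seq enc_seq [seq (if edge i j then enc_rat (weight i j) else Nil)
                       | j <- enum (vertex G)]
          | i <- enum (vertex G)].

Definition enc_instance (G : wgraph) (k : nat) : tree :=
  Cons (enc_graph G) (enc_nat k).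

(* A vertex set is output as its characteristic vector. *)
Definition enc_set (G : wgraph) (S : {set vertex G}) : tree :=
  enc_seq [seq enc_bool (i \in S) | i <- enum (vertex G)].

(* [polytime_alg A pre post]: in time polynomial in the size of the input,
   A returns, on every instance (G, k) satisfying [pre], an induced subgraph
   satisfying [post]. *)
Definition polytime_alg (A : cmd) (pre : wgraph -> nat -> Prop)
    (post : forall G : wgraph, nat -> {set vertex G} -> Prop) : Prop :=
  exists a d : nat, forall (G : wgraph) (k : nat), pre G k ->
    exists (t : nat) (s : store) (S : {set vertex G}),
      [/\ exec A (init (enc_instance G k)) t s,
          t <= a * tree_size (enc_instance G k) ^ d + a,
          s 0 = enc_set S
        & post G k S].

(* Main.v *)
(** Write W for the total edge weight. Let H be an optimal set of k vertices.
Starting from G, run A repeatedly, each time deleting from the graph the edges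
inside the set it returned, and let V be the union of the sets returned so far.
As long as at least half of W(H) has survived, the set S returned satisfies
W(S)/|S| >= d(H)/(2 gamma) in the current graph, and at least one edge is
deleted, so at most n^2 rounds keep half of W(H). At the first round where
either |V| >= k or half of W(H) is gone:
- if |V| < k, then V contains edges of weight W(H)/2 and any k-set containing V
  is good enough;
- otherwise d(V) >= d(H)/(2 gamma) and |V| <= k - 1 + beta k. Removing
  repeatedly the vertex whose removal keeps the most weight leads from |V| = m to
  k vertices with W at least k(k-1)/(m(m-1)) W(V) by averaging, which loses a
  factor (m-1)/(k-1) <= 1 + 2 beta in the density.
The algorithm does not know H: it pads or prunes the union of every round and
keeps the heaviest k-set.

To avoid reasoning about concrete while-programs, the functions on encoded data
that some program computes in polynomial time are shown to be closed under
composition, pairing, tests and bounded left folds; the algorithm is then an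
ordinary function on lists. *)
From mathcomp Require Import all_boot all_order all_algebra.
From mathcomp Require Import reals boolp.
From mathcomp Require Import zify ring lra.
(* After the libraries, whose [Nil] and [Cons] would hide those of [tree]. *)
Require Import Defs.
Import Order.TTheory GRing.Theory Num.Theory.

Set Implicit Arguments.
Unset Strict Implicit.
Unset Printing Implicit Defensive.

(** * Polynomial bounds *)

(** The base is at least 2 even for [n = 0], so constants and sums are absorbed into the exponent
    and the single number [c] describes the bound. *)
Definition poly_bounded (p : nat -> nat) : Prop :=
  exists c, forall n, p n <= (n + 2) ^ c.

Lemma leq_pow (n a b : nat) : a <= b -> (n + 2) ^ a <= (n + 2) ^ b.
Proof. by move=> ab; rewrite leq_pexp2l // addn2. Qed.

Lemma poly_bounded_const c : poly_bounded (fun=> c).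
Proof.
exists c => n; apply: leq_trans (ltnW (ltn_expl c (isT : 1 < 2))) _.
by case: c => // c; rewrite leq_exp2r // leq_addl.
Qed.

Lemma poly_bounded_id : poly_bounded id.
Proof. by exists 1 => n; rewrite expn1 leq_addr. Qed.

Lemma poly_bounded_pow c : poly_bounded (fun n => (n + 2) ^ c).
Proof. by exists c. Qed.

Lemma poly_bounded_add p q :
  poly_bounded p -> poly_bounded q -> poly_bounded (fun n => p n + q n).
Proof.
(* The extra factor [n + 2 >= 2] pays for having two summands. *)
move=> [c hc] [d hd]; exists (c + d).+1 => n.
have := leq_add (hc n) (hd n); move/leq_trans; apply.
rewrite expnS mulnDl addnC; apply: leq_trans (leq_addl _ _).
by rewrite mul2n -addnn leq_add // leq_pow // ?leq_addl ?leq_addr.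
Qed.

Lemma poly_bounded_mul p q :
  poly_bounded p -> poly_bounded q -> poly_bounded (fun n => p n * q n).
Proof. by move=> [c hc] [d hd]; exists (c + d) => n; rewrite expnD leq_mul. Qed.

Lemma poly_bounded_comp p q :
  poly_bounded p -> poly_bounded q -> poly_bounded (fun n => p (q n)).
Proof.
move=> [c hc] /poly_bounded_add/(_ (poly_bounded_const 2)) [d hd].
exists (d * c) => n; apply: leq_trans (hc _) _.
by rewrite expnM; case: c {hc} => // c; rewrite leq_exp2r.
Qed.

Ltac poly_bounded_tac := repeat first
  [ apply: poly_bounded_const | apply: poly_bounded_id
  | apply: poly_bounded_pow | eassumption
  | apply: poly_bounded_add | apply: poly_bounded_mul
  | match goal with |- poly_bounded (fun n => (@?q n + 2) ^ ?c) =>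
      apply: (@poly_bounded_comp (fun m => (m + 2) ^ c) q) end ].

(* [lia] fails on the powers unless they are opaque. *)
Ltac lia_pow := intros; repeat match goal with
  | H : context [expn ?a ?b] |- _ =>
      let p := fresh "p" in set (p := expn a b) in *; clearbody p
  | |- context [expn ?a ?b] =>
      let p := fresh "p" in set (p := expn a b) in *; clearbody p
  end; lia.

(** * Subroutine calls in while-programs *)

Lemma tree_size_gt0 u : 0 < tree_size u. Proof. by case: u. Qed.

(** Renaming variables by an offset moves a program to the block of the store starting at [m]; this
    is how one program calls another. *)
Fixpoint eshift (m : nat) (e : expr) : expr :=
  match e with
  | EVar x => EVar (m + x)
  | ENil => ENil
  | ECons e1 e2 => ECons (eshift m e1) (eshift m e2)
  | EHd e1 => EHd (eshift m e1)
  | ETl e1 => ETl (eshift m e1)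
  end.

Fixpoint cshift (m : nat) (c : cmd) : cmd :=
  match c with
  | Skip => Skip
  | Assign x e => Assign (m + x) (eshift m e)
  | Seq c1 c2 => Seq (cshift m c1) (cshift m c2)
  | If x c1 c2 => If (m + x) (cshift m c1) (cshift m c2)
  | While x c1 => While (m + x) (cshift m c1)
  end.

Fixpoint ebound (e : expr) : nat :=
  match e with
  | EVar x => x.+1
  | ENil => 0
  | ECons e1 e2 => maxn (ebound e1) (ebound e2)
  | EHd e1 | ETl e1 => ebound e1
  end.

Fixpoint cbound (c : cmd) : nat :=
  match c with
  | Skip => 0
  | Assign x e => maxn x.+1 (ebound e)
  | Seq c1 c2 => maxn (cbound c1) (cbound c2)
  | If x c1 c2 => maxn x.+1 (maxn (cbound c1) (cbound c2))
  | While x c1 => maxn x.+1 (cbound c1)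
  end.

Lemma eval_shift m b (s S : store) e : ebound e <= b ->
  (forall x, x < b -> S (m + x) = s x) -> eval S (eshift m e) = eval s e.
Proof.
move=> + sS; elim: e => //=.
- by move=> e1 IH1 e2 IH2; rewrite geq_max => /andP[/IH1 -> /IH2 ->].
- by move=> e IH /IH ->.
- by move=> e IH /IH ->.
Qed.

(** The stores need to agree only on a window containing the variables of [c], so a caller can keep
    its own data below [m]. *)
Lemma exec_shift m b c s t s' : exec c s t s' -> cbound c <= b ->
  forall S : store, (forall x, x < b -> S (m + x) = s x) ->
  exists S' : store, [/\ exec (cshift m c) S t S',
    forall x, x < b -> S' (m + x) = s' x & forall y, y < m -> S' y = S y].
Proof.
elim=> {c s t s'} /=.
- by move=> s _ S sS; exists S; split => //; exact: ExecSkip.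
- move=> x e s; rewrite geq_max => /andP[xb eb] S sS.
  have E := eval_shift eb sS.
  exists (update S (m + x) (eval s e)); split.
  + by rewrite -E; exact: ExecAssign.
  + by move=> y yb; rewrite /update eqn_add2l; case: eqP => // _; exact: sS.
  + by move=> y ym; rewrite /update; case: eqP => // yE; lia.
- move=> c1 c2 s t1 s1 t2 s2 _ IH1 _ IH2; rewrite geq_max => /andP[b1 b2] S sS.
  have [S1 [e1 h1 l1]] := IH1 b1 S sS; have [S2 [e2 h2 l2]] := IH2 b2 S1 h1.
  exists S2; split => //; first exact: ExecSeq e1 e2.
  by move=> y ym; rewrite l2 // l1.
- move=> x c1 c2 s t s' sx _ IH; rewrite !geq_max => /and3P[xb b1 b2] S sS.
  have [S' [e1 h1 l1]] := IH b1 S sS; exists S'; split => //.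
  by apply: ExecIfTrue => //; rewrite sS.
- move=> x c1 c2 s t s' sx _ IH; rewrite !geq_max => /and3P[xb b1 b2] S sS.
  have [S' [e1 h1 l1]] := IH b2 S sS; exists S'; split => //.
  by apply: ExecIfFalse => //; rewrite sS.
- move=> x c s sx; rewrite geq_max => /andP[xb b1] S sS.
  by exists S; split => //; apply: ExecWhileFalse; rewrite sS.
- move=> x c s t1 s1 t2 s2 sx _ IH1 _ IH2 /[dup] b12.
  rewrite geq_max => /andP[xb b1] S sS.
  have [S1 [e1 h1 l1]] := IH1 b1 S sS; have [S2 [e2 h2 l2]] := IH2 b12 S1 h1.
  exists S2; split => //; last by move=> y ym; rewrite l2 // l1.
  by apply: ExecWhileTrue e1 e2; rewrite sS.
Qed.

(** An assignment is charged for the tree it stores, so time bounds growth. Output sizes are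
    controlled this way. *)
Lemma exec_size c s t s' N : exec c s t s' ->
  (forall x, tree_size (s x) <= N) -> forall x, tree_size (s' x) <= N + t.
Proof.
move=> ex; elim: ex N => {c s t s'} //=.
- by move=> s N h x; apply: leq_trans (h x) _; rewrite leq_addr.
- move=> x e s N h y; rewrite /update; case: eqP => _; first by lia.
  by have := h y; lia.
- move=> c1 c2 s t1 s1 t2 s2 _ IH1 _ IH2 N h x.
  by rewrite addnA; apply: IH2; apply: IH1.
- by move=> x c1 c2 s t s' _ _ IH N h y; have := IH N h y; lia.
- by move=> x c1 c2 s t s' _ _ IH N h y; have := IH N h y; lia.
- by move=> x c s _ N h y; have := h y; lia.
- move=> x c s t1 s1 t2 s2 _ _ IH1 _ IH2 N h y.
  by have := IH2 _ (IH1 N h) y; lia.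
Qed.

Lemma exec_inv c s t s' : exec c s t s' ->
  match c with
  | Skip => t = 1 /\ s' = s
  | Assign x e => t = (tree_size (eval s e)).+1 /\ s' = update s x (eval s e)
  | Seq c1 c2 => exists t1 s1 t2,
      [/\ exec c1 s t1 s1, exec c2 s1 t2 s' & t = t1 + t2]
  | If x c1 c2 => exists2 t1,
      exec (if truthy (s x) then c1 else c2) s t1 s' & t = t1.+1
  | While x c1 => if truthy (s x) then exists t1 s1 t2,
      [/\ exec c1 s t1 s1, exec (While x c1) s1 t2 s' & t = (t1 + t2).+1]
      else t = 1 /\ s' = s
  end.
Proof.
case=> {c s t s'} //.
- by move=> *; do 3 eexists; split; eauto.
- by move=> x c1 c2 s t s' -> ?; exists t.
- by move=> x c1 c2 s t s' /negbTE -> ?; exists t.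
- by move=> x c s /negbTE ->.
- by move=> x c s t1 s1 t2 s2 -> *; exists t1, s1, t2.
Qed.

(** Serves to identify the output promised by an algorithm with the value of the function extracted
    from it. *)
Lemma exec_deterministic c s t s' : exec c s t s' ->
  forall t2 s2, exec c s t2 s2 -> s2 = s'.
Proof.
elim=> {c s t s'}.
- by move=> s t2 s2 /exec_inv[].
- by move=> x e s t2 s2 /exec_inv[].
- move=> c1 c2 s t1 s1 t2 s2 _ IH1 _ IH2 t3 s3 /exec_inv[u1 [v1 [u2 [+ + _]]]].
  by move=> /IH1 -> /IH2.
- by move=> x c1 c2 s t s' sx _ IH t2 s2 /exec_inv[t1]; rewrite sx => /IH.
- move=> x c1 c2 s t s' /negbTE sx _ IH t2 s2 /exec_inv[t1].
  by rewrite sx => /IH.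
- by move=> x c s /negbTE sx t2 s2 /exec_inv; rewrite sx => -[].
- move=> x c s t1 s1 t2 s2 sx _ IH1 _ IH2 t3 s3 /exec_inv; rewrite sx.
  by move=> [u1 [v1 [u2 [+ + _]]]] => /IH1 -> /IH2.
Qed.

(** A call inside a loop finds the leftovers of the previous call in its scratch space, while [init]
    demands [Nil] there. *)
Fixpoint clear (m b : nat) : cmd :=
  if b is b'.+1 then Seq (clear m b') (Assign (m + b') ENil) else Skip.

Lemma exec_clear m b s : exists s', [/\ exec (clear m b) s (b.*2.+1) s',
  forall x, x < b -> s' (m + x) = Nil & forall y, y < m -> s' y = s y].
Proof.
elim: b => [|b [s1 [e h l]]] /=.
  by exists s; split => //; exact: ExecSkip.
exists (update s1 (m + b) Nil); split.
- rewrite doubleS -[b.*2.+3]addn2; apply: ExecSeq e _; exact: (ExecAssign _ ENil).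
- move=> x xb; rewrite /update eqn_add2l; case: eqP => // xE; apply: h; lia.
- move=> y ym; rewrite /update; case: eqP => [?|_]; [lia|exact: l].
Qed.

(* Run [c] on the value of [y] and store its output in [x], with [m] and all
   larger variables as scratch space. *)
Definition call (m x y : nat) (c : cmd) : cmd :=
  Seq (clear m (cbound c).+1)
    (Seq (Assign m (EVar y)) (Seq (cshift m c) (Assign x (EVar m)))).

Lemma exec_call m x y c t s1 s : y < m -> exec c (init (s y)) t s1 ->
  exists t' s', [/\ exec (call m x y c) s t' s',
    t' <= (cbound c).*2 + 5 + (tree_size (s y)).*2 + t.*2,
    s' x = s1 0 & forall z, z < m -> z != x -> s' z = s z].
Proof.
move=> ym ex.
have [s2 [e2 h2 l2]] := exec_clear m (cbound c).+1 s.
set s3 := update s2 m (s y).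
have e3 : exec (Assign m (EVar y)) s2 (tree_size (s y)).+1 s3.
  by rewrite /s3 -(l2 y ym); exact: (ExecAssign _ (EVar y)).
have h3 z : z < (cbound c).+1 -> s3 (m + z) = init (s y) z.
  move=> zb; rewrite /s3 /init /update -{2}[m]addn0 eqn_add2l.
  by case: eqP => // _; exact: h2.
(* The window has [(cbound c).+1] variables so that it contains variable 0, the place of input and
   output, even if [c] mentions no variable. *)
have [s4 [e4 h4 l4]] := exec_shift ex (leqnSn _) h3.
have e5 := ExecAssign x (EVar m) s4.
have E := ExecSeq e2 (ExecSeq e3 (ExecSeq e4 e5)).
have m0 : s4 m = s1 0 by rewrite -(h4 0) // addn0.
do 2 eexists; split; first exact: E.
- rewrite /= m0.
  (* The final copy costs the size of the output, at most input size plus time; hence the doubled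
     terms in the bound. *)
  have : tree_size (s1 0) <= tree_size (s y) + t.
    apply: (exec_size ex) => z; rewrite /init /update; case: eqP => // _.
    exact: tree_size_gt0.
  by lia.
- by rewrite /update eqxx.
- move=> z zm /negbTE zx; rewrite /update zx l4 // /s3 /update l2 //.
  by case: eqP => // ?; lia.
Qed.

(** * Polynomial-time functions on encoded data *)

Class encoding (T : Type) := Encoding { encode : T -> tree }.

#[export] Instance encoding_bool : encoding bool := Encoding enc_bool.
#[export] Instance encoding_seq T `{encoding T} : encoding (seq T) :=
  Encoding (fun l => enc_seq (map encode l)).
#[export] Instance encoding_prod A B `{encoding A} `{encoding B} :
  encoding (A * B) := Encoding (fun z => Cons (encode z.1) (encode z.2)).
(* Not injective in general, but the encoding of a pair is never [Nil]. *)
#[export] Instance encoding_option T `{encoding T} : encoding (option T) :=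
  Encoding (fun o => if o is Some x then encode x else Nil).

Definition esize {T} `{encoding T} (x : T) : nat := tree_size (encode x).

Lemma esizeE {T} `{encoding T} (x : T) : tree_size (encode x) = esize x.
Proof. by []. Qed.

Lemma esize_gt0 {T} `{encoding T} (x : T) : 0 < esize x.
Proof. exact: tree_size_gt0. Qed.

Lemma esize_pair {A B} `{encoding A} `{encoding B} (z : A * B) :
  esize z = (esize z.1 + esize z.2).+1.
Proof. by []. Qed.

Lemma esize_cons {A} `{encoding A} (a : A) l :
  esize (a :: l) = (esize a + esize l).+1.
Proof. by []. Qed.

Lemma esize_cat {A} `{encoding A} (l1 l2 : seq A) :
  (esize (l1 ++ l2)).+1 = esize l1 + esize l2.
Proof. by elim: l1 => //= a l1 IH; rewrite !esize_cons; lia. Qed.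

Lemma size_esize {A} `{encoding A} (l : seq A) : size l < esize l.
Proof. by elim: l => //= a l IH; rewrite esize_cons; lia. Qed.

(** The domain [D] carries promises: the given algorithm says nothing about inputs that do not come
    from a graph. *)
Definition ptime {X Y} `{encoding X} `{encoding Y} (D : X -> Prop)
    (f : X -> Y) : Prop :=
  exists c k, forall x, D x -> exists t s,
    [/\ exec c (init (encode x)) t s, t <= (esize x + 2) ^ k
      & s 0 = encode (f x)].

Definition everywhere {X} (x : X) : Prop := True.

Section Closure.
Context {X : Type} `{encoding X}.
Implicit Type D : X -> Prop.

Lemma ptime_bound {Y} `{encoding Y} D (f : X -> Y) c p : poly_bounded p ->
  (forall x, D x -> exists t s, [/\ exec c (init (encode x)) t s,
     t <= p (esize x) & s 0 = encode (f x)]) -> ptime D f.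
Proof.
move=> [k hk] h; exists c, k => x /h[t [s [e ht es]]].
by exists t, s; split => //; apply: leq_trans ht (hk _).
Qed.

Lemma ptime_esize {Y} `{encoding Y} D (f : X -> Y) : ptime D f ->
  exists k, forall x, D x -> esize (f x) <= (esize x + 2) ^ k.
Proof.
move=> [c [k h]].
have [k' hk'] := poly_bounded_add poly_bounded_id (poly_bounded_pow k).
exists k' => x /h[t [s [e ht es]]]; apply: leq_trans (hk' _).
apply: leq_trans (leq_add (leqnn _) ht).
rewrite /esize -es; apply: (exec_size e) => z; rewrite /init /update.
by case: eqP => // _; exact: tree_size_gt0.
Qed.

Lemma ptime_sub {Y} `{encoding Y} D E (f : X -> Y) :
  (forall x, D x -> E x) -> ptime E f -> ptime D f.
Proof. by move=> DE [c [k h]]; exists c, k => x /DE/h. Qed.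

(** Only the encodings are compared, so the result types may differ: a pair of a head and a tail is
    encoded like the list they form. *)
Lemma ptime_ext {Y Z} `{encoding Y} `{encoding Z} D (f : X -> Y) (g : X -> Z) :
  (forall x, D x -> encode (f x) = encode (g x)) -> ptime D f -> ptime D g.
Proof.
move=> fg [c [k h]]; exists c, k => x Dx; have [t [s [e ht es]]] := h x Dx.
by exists t, s; rewrite -fg.
Qed.

Lemma ptime_expr {Y} `{encoding Y} D (f : X -> Y) e :
  (forall x, encode (f x) = eval (init (encode x)) e) -> ptime D f.
Proof.
move=> fe.
have eb : exists2 p, poly_bounded p &
    forall u, tree_size (eval (init u) e) <= p (tree_size u).
  elim: e {fe} => /=.
  - move=> x; exists id; first exact: poly_bounded_id.
    move=> u; rewrite /init /update; case: eqP => //= _; exact: tree_size_gt0.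
  - exists (fun=> 1) => //; exact: poly_bounded_const.
  - move=> e1 [p1 h1 l1] e2 [p2 h2 l2]; exists (fun n => p1 n + p2 n + 1).
      by poly_bounded_tac.
    by move=> u; have := l1 u; have := l2 u; lia.
  - move=> e1 [p1 h1 l1]; exists p1 => // u; apply: leq_trans (l1 u).
    by case: (eval _ _) => //= a b; lia.
  - move=> e1 [p1 h1 l1]; exists p1 => // u; apply: leq_trans (l1 u).
    by case: (eval _ _) => //= a b; lia.
have [p hp lp] := eb.
apply: (@ptime_bound _ _ D f (Assign 0 e) (fun n => p n + 1)).
  by poly_bounded_tac.
move=> x _; do 2 eexists; split; first exact: ExecAssign.
- by rewrite addn1 ltnS.
- by rewrite fe.
Qed.

Lemma ptime_id D : ptime D id.
Proof. exact: (@ptime_expr _ _ _ _ (EVar 0)). Qed.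

Lemma ptime_nil {A} `{encoding A} D : ptime D (fun=> [::] : seq A).
Proof. exact: (@ptime_expr _ _ _ _ ENil). Qed.

Lemma ptime_bool D (b : bool) : ptime D (fun=> b).
Proof.
by apply: (@ptime_expr _ _ _ _ (if b then ECons ENil ENil else ENil)) => x; case: b.
Qed.

Lemma ptime_none {A} `{encoding A} D : ptime D (fun=> None : option A).
Proof. exact: (@ptime_expr _ _ _ _ ENil). Qed.

End Closure.

Section Composition.
Context {X Y Z : Type} `{encoding X} `{encoding Y} `{encoding Z}.
Implicit Type D : X -> Prop.

Lemma ptime_comp (E : Y -> Prop) D (g : Y -> Z) (f : X -> Y) :
  ptime E g -> ptime D f -> (forall x, D x -> E (f x)) ->
  ptime D (fun x => g (f x)).
Proof.
move=> [cg [kg hg]] hf DE; have [kf sf] := ptime_esize hf.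
case: hf => [cf [k hf]].
apply: (@ptime_bound _ _ _ _ D _ (Seq (call 2 1 0 cf) (call 2 0 1 cg))
  (fun n => ((cbound cf).*2 + 5 + n * 2 + (n + 2) ^ k * 2) +
     ((cbound cg).*2 + 5 + (n + 2) ^ kf * 2 + ((n + 2) ^ kf + 2) ^ kg * 2))).
  by poly_bounded_tac.
move=> x Dx; have [t [s [e ht es]]] := hf x Dx.
have [t1 [s1 [e1 ht1 es1 _]]] :=
  @exec_call 2 1 0 cf t s (init (encode x)) isT e.
have [u [v [e' hu ev]]] := hg _ (DE x Dx).
rewrite -es -es1 in e'.
have [t2 [s2 [e2 ht2 es2 _]]] := @exec_call 2 0 1 cg u v s1 isT e'.
exists (t1 + t2), s2; split; [exact: ExecSeq e1 e2| |by rewrite es2].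
have := sf x Dx => szf.
have : (esize (f x) + 2) ^ kg <= ((esize x + 2) ^ kf + 2) ^ kg.
  by case: (kg) => // kk; rewrite leq_exp2r // leq_add2r.
move: ht1 ht2; rewrite es1 es !esizeE.
by lia_pow.
Qed.

Lemma ptime_pair D (f : X -> Y) (g : X -> Z) :
  ptime D f -> ptime D g -> ptime D (fun x => (f x, g x)).
Proof.
move=> hf hg; have [kf sf] := ptime_esize hf; have [kg sg] := ptime_esize hg.
case: hf hg => [cf [k hf]] [cg [l hg]].
apply: (@ptime_bound _ _ _ _ D _ (Seq (call 3 1 0 cf) (Seq (call 3 2 0 cg)
    (Assign 0 (ECons (EVar 1) (EVar 2)))))
  (fun n => ((cbound cf).*2 + 5 + n * 2 + (n + 2) ^ k * 2) +
     ((cbound cg).*2 + 5 + n * 2 + (n + 2) ^ l * 2) +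
     ((n + 2) ^ kf + (n + 2) ^ kg + 2))).
  by poly_bounded_tac.
move=> x Dx; have [t [s [e ht es]]] := hf x Dx.
have [t1 [s1 [e1 ht1 es1 fr1]]] :=
  @exec_call 3 1 0 cf t s (init (encode x)) isT e.
have s10 : s1 0 = encode x by rewrite fr1.
have [u [v [e' hu ev]]] := hg _ Dx.
rewrite -s10 in e'.
have [t2 [s2 [e2 ht2 es2 fr2]]] := @exec_call 3 2 0 cg u v s1 isT e'.
do 2 eexists; split.
- exact: ExecSeq e1 (ExecSeq e2 (ExecAssign _ _ _)).
- move: (sf x Dx) (sg x Dx) ht1 ht2.
  rewrite /= fr2 // es2 es1 es ev s10 !esizeE; lia_pow.
- by rewrite /update /= fr2 // es2 es1 es ev.
Qed.

(** Each branch has to be polynomial only where it is taken; the match on an option relies on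
    this. *)
Lemma ptime_cond D (b : X -> bool) (f g : X -> Y) : ptime D b ->
  ptime (fun x => D x /\ b x) f -> ptime (fun x => D x /\ ~~ b x) g ->
  ptime D (fun x => if b x then f x else g x).
Proof.
move=> [cb [kb hb]] [cf [kf hf]] [cg [kg hg]].
apply: (@ptime_bound _ _ _ _ D _ (Seq (call 2 1 0 cb)
    (If 1 (call 2 0 0 cf) (call 2 0 0 cg)))
  (fun n => ((cbound cb).*2 + 5 + n * 2 + (n + 2) ^ kb * 2) +
     ((cbound cf).*2 + 5 + n * 2 + (n + 2) ^ kf * 2 + 1) +
     ((cbound cg).*2 + 5 + n * 2 + (n + 2) ^ kg * 2))).
  by poly_bounded_tac.
move=> x Dx; have [t [s [e ht es]]] := hb x Dx.
have [t1 [s1 [e1 ht1 es1 fr1]]] :=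
  @exec_call 2 1 0 cb t s (init (encode x)) isT e.
have s10 : s1 0 = encode x by rewrite fr1.
rewrite !esizeE in ht1.
have tb : truthy (s1 1) = b x by rewrite es1 es; case: (b x).
case bx: (b x) in tb *.
- have [u [v [e' hu ev]]] := hf _ (conj Dx bx); rewrite -s10 in e'.
  have [t2 [s2 [e2 ht2 es2 fr2]]] := @exec_call 2 0 0 cf u v s1 isT e'.
  do 2 eexists; split; [exact: ExecSeq e1 (ExecIfTrue _ tb e2)| |by rewrite es2].
  by move: ht1 ht2; rewrite s10 !esizeE; lia_pow.
- have [u [v [e' hu ev]]] := hg _ (conj Dx (negbT bx)); rewrite -s10 in e'.
  have [t2 [s2 [e2 ht2 es2 fr2]]] := @exec_call 2 0 0 cg u v s1 isT e'.
  do 2 eexists; split; [exact: ExecSeq e1 (ExecIfFalse _ (negbT tb) e2)| |by rewrite es2].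
  by move: ht1 ht2; rewrite s10 !esizeE; lia_pow.
Qed.

Lemma ptime_if D (b : X -> bool) (f g : X -> Y) : ptime D b ->
  ptime D f -> ptime D g -> ptime D (fun x => if b x then f x else g x).
Proof.
move=> hb hf hg; apply: ptime_cond => //.
- by apply: ptime_sub hf => x [].
- by apply: ptime_sub hg => x [].
Qed.

End Composition.

(** * Bounded left folds *)

Section Fold.
Context {X A B : Type} `{encoding X} `{encoding A} `{encoding B}.

(** Iterating a polynomial-time step can blow up exponentially, so a polynomial bound on all
    reachable accumulators is a hypothesis. [E] is the promise under which the step is computed; it
    has to hold at reachable accumulators only. *)
Lemma ptime_foldl (D : X -> Prop) (E : X * A * B -> Prop)
    (g : X -> A -> B -> A) (a : X -> A) (l : X -> seq B) (p : nat -> nat) :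
  ptime D a -> ptime D l -> ptime E (fun z => g z.1.1 z.1.2 z.2) ->
  (forall x l1 b l2, D x -> l x = l1 ++ b :: l2 ->
     E (x, foldl (g x) (a x) l1, b)) ->
  poly_bounded p ->
  (forall x l1 l2, D x -> l x = l1 ++ l2 ->
     esize (foldl (g x) (a x) l1) <= p (esize x)) ->
  ptime D (fun x => foldl (g x) (a x) (l x)).
Proof.
move=> ha hl [cg [kg hg]] DE hp hsz.
have [kl sl] := ptime_esize hl.
case: ha hl => [ca [ka ha]] [cl [k hl]].
(* Variable 0 keeps the input, 1 the rest of the list, 2 the accumulator, and 3 the argument of the
   step. *)
pose body := Seq (Assign 3 (ECons (ECons (EVar 0) (EVar 2)) (EHd (EVar 1))))
  (Seq (call 4 2 3 cg) (Assign 1 (ETl (EVar 1)))).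
(* [zs] bounds the size of the argument of a step, [bt] the cost of one iteration. *)
pose zs n := n + p n + (n + 2) ^ kl + 2.
pose bt n := zs n + 1 + ((cbound cg).*2 + 5 + zs n * 2 + (zs n + 2) ^ kg * 2)
  + (n + 2) ^ kl + 2.
have zsP : poly_bounded zs by rewrite /zs; poly_bounded_tac.
apply: (@ptime_bound _ _ _ _ D _ (Seq (call 4 1 0 cl) (Seq (call 4 2 0 ca)
    (Seq (While 1 body) (Assign 0 (EVar 2)))))
  (fun n => ((cbound cl).*2 + 5 + n * 2 + (n + 2) ^ k * 2) +
     ((cbound ca).*2 + 5 + n * 2 + (n + 2) ^ ka * 2) +
     ((n + 2) ^ kl * bt n + 1) + (p n + 1))).
  rewrite /bt; poly_bounded_tac.
move=> x Dx; have [t [s [e ht es]]] := hl x Dx.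
have [t1 [s1 [e1 ht1 es1 fr1]]] :=
  @exec_call 4 1 0 cl t s (init (encode x)) isT e.
have s10 : s1 0 = encode x by rewrite fr1.
rewrite !esizeE in ht1.
have [u [v [e' hu ev]]] := ha _ Dx; rewrite -s10 in e'.
have [t2 [s2 [e2 ht2 es2 fr2]]] := @exec_call 4 2 0 ca u v s1 isT e'.
have loop : forall l2 l1 s, l x = l1 ++ l2 -> s 0 = encode x ->
    s 1 = encode l2 -> s 2 = encode (foldl (g x) (a x) l1) ->
    exists t s', [/\ exec (While 1 body) s t s', t <= size l2 * bt (esize x) + 1
      & s' 2 = encode (foldl (g x) (a x) (l x))].
  elim=> [|b l2 IH] l1 r lE r0 r1 r2.
    exists 1, r; split => //; last by rewrite lE cats0.
    by apply: ExecWhileFalse; rewrite r1.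
  set z := (x, foldl (g x) (a x) l1, b).
  have lE' : (esize (l x)).+1 = esize l1 + (esize b + esize l2).+1.
    by rewrite lE esize_cat esize_cons.
  have := sl x Dx => slx; have l1_gt0 : 0 < esize l1 := esize_gt0 l1.
  have z_le : esize z <= zs (esize x).
    have := hsz x l1 (b :: l2) Dx lE.
    by rewrite /z !esize_pair /zs /=; lia_pow.
  have [u1 [v1 [e3 hu1 ev1]]] := hg z (DE x l1 b l2 Dx lE).
  have eA := ExecAssign 3 (ECons (ECons (EVar 0) (EVar 2)) (EHd (EVar 1))) r.
  set ra := update r 3 _ in eA.
  have ra3 : ra 3 = encode z by rewrite /ra /update /= r0 r1 r2.
  rewrite -ra3 in e3.
  have [t4 [s4 [e4 ht4 es4 fr4]]] := @exec_call 4 2 3 cg u1 v1 ra isT e3.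
  have e5 := ExecAssign 1 (ETl (EVar 1)) s4.
  have s41 : s4 1 = encode (b :: l2) by rewrite fr4 // /ra /update.
  have [||||tw [sw [ew htw esw]]] :=
    IH (rcons l1 b) (update s4 1 (eval s4 (ETl (EVar 1)))).
  - by rewrite lE cat_rcons.
  - by rewrite /update /= fr4 // /ra /update /= r0.
  - by rewrite /update /= s41.
  - by rewrite /update /= es4 ev1 foldl_rcons.
  do 2 eexists; split; [|  |exact: esw].
    apply: ExecWhileTrue ew; first by rewrite r1.
    exact: ExecSeq eA (ExecSeq e4 e5).
  have kgle : (esize z + 2) ^ kg <= (zs (esize x) + 2) ^ kg.
    by case: (kg) => // kk; rewrite leq_exp2r // leq_add2r.
  have zE : esize z = ((esize x + esize (foldl (g x) (a x) l1)).+1 + esize b).+1 by [].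
  move: ht4; rewrite ra3 /= s41 r0 r1 r2 /= !esizeE mulSn.
  have -> : tree_size (enc_seq [seq encode i | i <- l2]) = esize l2 by [].
  have : bt (esize x) = zs (esize x) + 1 + ((cbound cg).*2 + 5 +
    zs (esize x) * 2 + (zs (esize x) + 2) ^ kg * 2) + (esize x + 2) ^ kl + 2.
    by [].
  by move: htw; set w := _ * bt _; lia_pow.
have [||||tw [sw [ew htw esw]]] := loop (l x) [::] s2 => //.
- by rewrite fr2.
- by rewrite fr2 // es1 es.
- by rewrite es2 ev.
do 2 eexists; split.
- exact: ExecSeq e1 (ExecSeq e2 (ExecSeq ew (ExecAssign _ _ _))).
- rewrite /= esw !esizeE.
  have := hsz x (l x) [::] Dx; rewrite cats0 => /(_ erefl) szl.
  have : size (l x) <= (esize x + 2) ^ kl.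
    by apply: leq_trans (sl x Dx); exact/ltnW/size_esize.
  move/(fun h => leq_mul h (leqnn (bt (esize x)))) => ?.
  by move: ht2; rewrite s10 !esizeE; lia_pow.
- by rewrite /update /= esw.
Qed.

End Fold.

Section Derived.
Context {X : Type} `{encoding X}.
Implicit Type D : X -> Prop.

Lemma ptime_app1 {A C} `{encoding A} `{encoding C} (h : A -> C) :
  ptime everywhere h ->
  forall D f, ptime D f -> ptime D (fun x => h (f x)).
Proof. by move=> hh D f hf; apply: (ptime_comp hh hf). Qed.

Lemma ptime_app2 {A B C} `{encoding A} `{encoding B} `{encoding C}
    (h : A -> B -> C) : ptime everywhere (fun z => h z.1 z.2) ->
  forall D f g, ptime D f -> ptime D g -> ptime D (fun x => h (f x) (g x)).
Proof. by move=> hh D f g hf hg; apply: (ptime_comp hh (ptime_pair hf hg)). Qed.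

Lemma ptime_app3 {A B B' C} `{encoding A} `{encoding B} `{encoding B'}
    `{encoding C} (h : A -> B -> B' -> C) :
  ptime everywhere (fun z => h z.1.1 z.1.2 z.2) ->
  forall D f g g', ptime D f -> ptime D g -> ptime D g' ->
  ptime D (fun x => h (f x) (g x) (g' x)).
Proof.
move=> hh D f g g' hf hg hg'.
by apply: (ptime_comp hh (ptime_pair (ptime_pair hf hg) hg')).
Qed.

Lemma ptime_fst {A B} `{encoding A} `{encoding B} D (f : X -> A * B) :
  ptime D f -> ptime D (fun x => (f x).1).
Proof.
apply: ptime_app1; exact: (@ptime_expr _ _ _ _ _ _ (EHd (EVar 0))).
Qed.

Lemma ptime_snd {A B} `{encoding A} `{encoding B} D (f : X -> A * B) :
  ptime D f -> ptime D (fun x => (f x).2).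
Proof.
apply: ptime_app1; exact: (@ptime_expr _ _ _ _ _ _ (ETl (EVar 0))).
Qed.

Lemma ptime_cons {A} `{encoding A} D (f : X -> A) g :
  ptime D f -> ptime D g -> ptime D (fun x => f x :: g x).
Proof. by move=> hf hg; apply: ptime_ext (ptime_pair hf hg). Qed.

Lemma ptime_head {A} `{encoding A} (d : A) D f : encode d = Nil ->
  ptime D f -> ptime D (fun x => head d (f x)).
Proof.
move=> dN; apply: ptime_app1; apply: (@ptime_expr _ _ _ _ _ _ (EHd (EVar 0))).
by case.
Qed.

Lemma ptime_behead {A} `{encoding A} D (f : X -> seq A) :
  ptime D f -> ptime D (fun x => behead (f x)).
Proof.
apply: ptime_app1; apply: (@ptime_expr _ _ _ _ _ _ (ETl (EVar 0))); by case.
Qed.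

(** The option is over pairs because a pair is never encoded by [Nil], so that a test on a variable
    recognizes [None]. *)
Lemma ptime_omatch {A B C} `{encoding A} `{encoding B} `{encoding C} D
    (o : X -> option (A * B)) (f : X -> A * B -> C) (g : X -> C) :
  ptime D o -> ptime everywhere (fun z => f z.1 z.2) -> ptime D g ->
  ptime D (fun x => if o x is Some p then f x p else g x).
Proof.
move=> ho hf hg.
have isS : ptime everywhere (fun u : option (A * B) => isSome u).
  exists (If 0 (Assign 0 (ECons ENil ENil)) Skip), 3 => -[p|] _.
    do 2 eexists; split; [exact: ExecIfTrue (ExecAssign _ _ _)| |by []].
    by rewrite /=; move: (esize _) => n; rewrite !expnS; nia.
  by do 2 eexists; split; [exact: ExecIfFalse (ExecSkip _)| |].
(* On this domain [Some p] has the same encoding as [p], so the program for [f] serves unchanged. *)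
have hfo : ptime (fun z => isSome z.2)
    (fun z : X * option (A * B) => if z.2 is Some p then f z.1 p else g z.1).
  have [c [k hc]] := hf; exists c, k => -[x [p|]] //= _; exact: (hc (x, p) I).
have hpair : ptime D (fun x => (x, o x)) by apply: ptime_pair ho; exact: ptime_id.
apply: (@ptime_ext _ _ _ _ _ _ _ (fun x => if isSome (o x) then
    (if o x is Some p then f x p else g x) else g x)); first by move=> x _; case: (o x).
apply: ptime_cond; first exact: (ptime_app1 isS ho).
- by apply: (ptime_comp hfo (ptime_sub _ hpair)) => x [].
- by apply: ptime_sub hg => x [].
Qed.

(** If a step adds an amount that does not depend on the accumulator, growth is linear in the number
    of steps. A measure [mu] replaces [esize] because the encoding of a bit list can grow by a
    constant factor while its length stays the same. *)
Lemma ptime_foldl_measure {A B} `{encoding A} `{encoding B} D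
    (g : X -> A -> B -> A) (a : X -> A) (l : X -> seq B) (mu : A -> nat) c k :
  (forall a, esize a <= c * (mu a).+1) -> (forall a, mu a <= esize a) ->
  (forall x a b, mu (g x a b) <= mu a + (esize x + esize b + 2) ^ k) ->
  ptime D a -> ptime D l -> ptime everywhere (fun z => g z.1.1 z.1.2 z.2) ->
  ptime D (fun x => foldl (g x) (a x) (l x)).
Proof.
move=> mu1 mu2 muS ha hl hg.
have [ka sa] := ptime_esize ha; have [kl sl] := ptime_esize hl.
apply: (ptime_foldl (p := fun n => c *
  ((n + 2) ^ ka + (n + 2) ^ kl * (n + (n + 2) ^ kl + 2) ^ k + 1)) ha hl hg) => //.
  by poly_bounded_tac.
move=> x l1 l2 Dx lE; apply: leq_trans (mu1 _) _; rewrite leq_mul2l; apply/orP; right.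
rewrite addn1 ltnS; apply: leq_trans (leq_add (sa x Dx) (leqnn _)).
have lx := sl x Dx.
have sz1 : size l1 <= (esize x + 2) ^ kl.
  apply: leq_trans lx; rewrite lE; apply: leq_trans (ltnW (size_esize _)).
  by rewrite size_cat leq_addr.
have all1 : all (fun b => esize b <= (esize x + 2) ^ kl) l1.
  apply: (@sub_all _ (fun b => esize b <= esize (l x))) => [b /leq_trans|].
    exact.
  rewrite lE; elim: (l1) => //= b l1' IH; rewrite esize_cons; apply/andP; split.
    by lia.
  by apply: sub_all IH => b' /leq_trans; apply; lia.
apply: (@leq_trans (mu (a x) + size l1 * (esize x + (esize x + 2) ^ kl + 2) ^ k));
  last by rewrite leq_add // leq_mul2r sz1 orbT.
elim/last_ind: l1 {lE sz1} all1 => [|l1 b IH]; first by rewrite addn0.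
rewrite all_rcons => /andP[hb /IH {}IH]; rewrite foldl_rcons size_rcons mulSn.
apply: leq_trans (muS _ _ _) _; rewrite [X in _ <= _ + X]addnC addnA leq_add //.
by case: (k) => // kk; rewrite leq_exp2r // !leq_add.
Qed.

Lemma ptime_foldl_esize {A B} `{encoding A} `{encoding B} D
    (g : X -> A -> B -> A) (a : X -> A) (l : X -> seq B) k :
  (forall x a b, esize (g x a b) <= esize a + (esize x + esize b + 2) ^ k) ->
  ptime D a -> ptime D l -> ptime everywhere (fun z => g z.1.1 z.1.2 z.2) ->
  ptime D (fun x => foldl (g x) (a x) (l x)).
Proof. by apply: (@ptime_foldl_measure _ _ _ _ _ _ _ _ esize 1) => a'; lia. Qed.

End Derived.

(** * List operations obtained from folds *)

Section Lists.
Context {X : Type} `{encoding X}.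
Implicit Type D : X -> Prop.

Lemma foldl_cons {A} (s1 s2 : seq A) :
  foldl (fun s x => x :: s) s2 s1 = catrev s1 s2.
Proof. by elim: s1 s2 => //= x s1 IH s2. Qed.

Lemma ptime_catrev {A} `{encoding A} D (f g : X -> seq A) :
  ptime D f -> ptime D g -> ptime D (fun x => catrev (f x) (g x)).
Proof.
move=> hf hg; apply: (@ptime_ext _ _ _ _ _ _ _
  (fun x => foldl (fun s x => x :: s) (g x) (f x))).
  by move=> x _; rewrite foldl_cons.
apply: (ptime_foldl_esize (g := fun _ s x => x :: s) (k := 1)) => //.
  by move=> x s b; rewrite esize_cons expn1; lia.
apply: ptime_cons; first by apply: ptime_snd; exact: ptime_id.
by apply: ptime_snd; apply: ptime_fst; exact: ptime_id.
Qed.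

Lemma ptime_rev {A} `{encoding A} D (f : X -> seq A) :
  ptime D f -> ptime D (fun x => rev (f x)).
Proof. by move=> hf; apply: ptime_catrev hf _; exact: ptime_nil. Qed.

Lemma foldl_map_rev {A B} (f : A -> B) s r :
  foldl (fun s x => f x :: s) r s = rev (map f s) ++ r.
Proof. by elim: s r => //= x s IH r; rewrite IH rev_cons cat_rcons. Qed.

Lemma ptime_map {A B} `{encoding A} `{encoding B} D (f : X -> A -> B)
    (l : X -> seq A) :
  ptime everywhere (fun z => f z.1 z.2) -> ptime D l ->
  ptime D (fun x => map (f x) (l x)).
Proof.
move=> hf hl; have [kf sf] := ptime_esize hf.
have [k hk] : poly_bounded (fun n => (n + 1 + 2) ^ kf + 1) by poly_bounded_tac.
apply: (@ptime_ext _ _ _ _ _ _ _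
  (fun x => rev (foldl (fun s y => f x y :: s) [::] (l x)))).
  by move=> x _; rewrite foldl_map_rev cats0 revK.
apply: ptime_rev; apply: (ptime_foldl_esize (g := fun x s b => f x b :: s) (k := k)) => //.
- move=> x s b; rewrite esize_cons.
  have /= := sf (x, b) I; rewrite esize_pair /= -addn1.
  set n := esize x + esize b; have := hk n; lia_pow.
- exact: ptime_nil.
- apply: ptime_cons; last by apply: ptime_snd; apply: ptime_fst; exact: ptime_id.
  have hz : ptime everywhere (fun z : X * seq B * A => (z.1.1, z.2)).
    apply: ptime_pair; last by apply: ptime_snd; exact: ptime_id.
    by do 2 apply: ptime_fst; exact: ptime_id.
  exact: (ptime_comp hf hz).
Qed.

End Lists.

(** * Binary arithmetic *)

(** Such a function is a table of eight constants behind nested tests. *)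
Lemma ptime_bool_fun {X} `{encoding X} (h : bool -> bool -> bool -> bool)
    (D : X -> Prop) f1 f2 f3 : ptime D f1 -> ptime D f2 -> ptime D f3 ->
  ptime D (fun x => h (f1 x) (f2 x) (f3 x)).
Proof.
move=> h1 h2 h3; apply: (@ptime_ext _ _ _ _ _ _ _ (fun x => if f1 x then
  if f2 x then (if f3 x then h true true true else h true true false)
    else (if f3 x then h true false true else h true false false) else
  if f2 x then (if f3 x then h false true true else h false true false)
    else (if f3 x then h false false true else h false false false))).
  by move=> x _; case: (f1 x) (f2 x) (f3 x) => [] [] [].
by do ?apply: ptime_if => //; apply: ptime_bool.
Qed.

Definition sum3 (a b c : bool) : bool := a (+) b (+) c.
Definition carry3 (a b c : bool) : bool := a + b + c > 1.

Ltac ptime_tac := lazymatch goal with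
  | |- @ptime _ _ _ _ _ (fun x => x) => exact: ptime_id
  | |- @ptime _ _ _ _ _ (fun x => [::]) => exact: ptime_nil
  | |- @ptime _ _ _ _ _ (fun x => true) => exact: ptime_bool
  | |- @ptime _ _ _ _ _ (fun x => false) => exact: ptime_bool
  | |- @ptime _ _ _ _ _ (fun x => None) => exact: ptime_none
  | |- @ptime _ _ _ _ _ (fun x => (_, _)) => refine (ptime_pair _ _); ptime_tac
  | |- @ptime _ _ _ _ _ (fun x => _ :: _) => refine (ptime_cons _ _); ptime_tac
  | |- @ptime _ _ _ _ _ (fun x => if _ then _ else _) => refine (ptime_if _ _ _); ptime_tac
  | |- @ptime _ _ _ _ _ (fun x => sum3 _ _ _) =>
      refine (ptime_bool_fun sum3 _ _ _); ptime_tac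
  | |- @ptime _ _ _ _ _ (fun x => carry3 _ _ _) =>
      refine (ptime_bool_fun carry3 _ _ _); ptime_tac
  | |- @ptime _ _ _ _ _ (fun x => head _ _) =>
      refine (ptime_head _ _); [by [] | ptime_tac]
  | |- @ptime _ _ _ _ _ (fun x => behead _) => refine (ptime_behead _); ptime_tac
  | |- @ptime _ _ _ _ _ (fun x => rev _) => refine (ptime_rev _); ptime_tac
  | |- @ptime _ _ _ _ _ (fun x => catrev _ _) => refine (ptime_catrev _ _); ptime_tac
  | |- @ptime _ _ _ _ _ (fun x => fst _) => refine (ptime_fst _); ptime_tac
  | |- @ptime _ _ _ _ _ (fun x => snd _) => refine (ptime_snd _); ptime_tac
  | |- @ptime _ _ _ _ _ (fun x => _) => assumption
  | |- @ptime ?X ?Y ?eX ?eY ?D ?f =>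
      first [ assumption
            | change (@ptime X Y eX eY D (fun x => f x)); ptime_tac ]
  end.

(** High-order zeros are allowed, so a number has many representations and is compared through
    [lt_bits], not by equality of lists. *)
Definition bval (s : seq bool) : nat := foldr (fun (b : bool) n => b + n.*2) 0 s.

Lemma bval_bits n : bval (bits n) = n.
Proof.
rewrite -[RHS]bin_of_natK /bits; case: (bin_of_nat n) => //= p.
elim: p => //= p ->; rewrite /nat_of_pos -/nat_of_pos NatTrec.doubleE; lia.
Qed.

Lemma bval_rcons s b : bval (rcons s b) = bval s + b * 2 ^ size s.
Proof.
elim: s => [|a s IH] /=; first by lia.
by rewrite IH expnS; nia.
Qed.

Lemma bval_head s : bval s = head false s + (bval (behead s)).*2.
Proof. by case: s. Qed.

Lemma esize_bool (b : bool) : esize b <= 3. Proof. by case: b. Qed.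

Lemma esize_bits_le (s : seq bool) : esize s <= 4 * (size s).+1.
Proof.
elim: s => //= b s IH; rewrite esize_cons.
by have := esize_bool b; lia.
Qed.

Lemma size_bits_lt (s : seq bool) : size s < esize s.
Proof. exact: size_esize. Qed.

(** The state holds the unread bits of the second summand, the carry, and the output in reverse; the
    fold reads the first summand. *)
Definition add_step (st : seq bool * bool * seq bool) (b : bool) :=
  (behead st.1.1, carry3 b (head false st.1.1) st.1.2,
   sum3 b (head false st.1.1) st.1.2 :: st.2).

Definition add_loop st (s : seq bool) := foldl add_step st s.

(* The second loop propagates the carry through the bits of [y] left over by
   the first one. *)
Definition add_flush (st : seq bool * bool * seq bool) :=
  add_loop ([::], st.1.2, st.2) st.1.1.

Definition add_out (st : seq bool * bool * seq bool) := rev (st.1.2 :: st.2).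

Definition add_bits (x y : seq bool) : seq bool :=
  add_out (add_flush (add_loop (y, false, [::]) x)).

Lemma ptime_add_loop {X} `{encoding X} (D : X -> Prop) f g :
  ptime D f -> ptime D g -> ptime D (fun x => add_loop (f x) (g x)).
Proof.
move=> hf hg; rewrite /add_loop.
apply: (ptime_foldl_measure (g := fun=> add_step) (c := 20) (k := 1)
  (mu := fun st : seq bool * bool * seq bool => size st.1.1 + size st.2)) => //.
- move=> [[y c] o] /=; rewrite !esize_pair /=.
  have := esize_bits_le y; have := esize_bits_le o.
  by have := esize_bool c; lia.
- move=> [[y c] o] /=; rewrite !esize_pair /=.
  have := size_bits_lt y.
  by have := size_bits_lt o; lia.
- by move=> x [[y c] o] b /=; rewrite size_behead expn1; lia.
- by rewrite /add_step; ptime_tac.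
Qed.

Lemma ptime_add_bits {X} `{encoding X} (D : X -> Prop) f g :
  ptime D f -> ptime D g -> ptime D (fun x => add_bits (f x) (g x)).
Proof.
apply: ptime_app2; rewrite /add_bits.
apply: (@ptime_app1 _ _ _ _ _ _ add_out); first by rewrite /add_out; ptime_tac.
apply: (@ptime_app1 _ _ _ _ _ _ add_flush).
  by rewrite /add_flush; apply: ptime_add_loop; ptime_tac.
by apply: ptime_add_loop; ptime_tac.
Qed.

(** The invariant of schoolbook addition: the output so far plus, shifted by its length, all that is
    still to be added. *)
Lemma add_loopP s st : let st' := add_loop st s in
  bval (rev st'.2) + 2 ^ size st'.2 * (st'.1.2 + bval st'.1.1) =
  bval (rev st.2) + 2 ^ size st.2 * (st.1.2 + bval st.1.1 + bval s).
Proof.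
rewrite /add_loop /=; elim: s st => [|b s IH] [[y c] o] /=; first by rewrite addn0.
rewrite IH /= rev_cons bval_rcons size_rev expnS (bval_head y) -!addnA; congr addn.
set h := head _ _; set t := bval (behead y); move: (2 ^ _) (bval s) => p v.
by rewrite /sum3 /carry3; case: b h c => [] [] [] /=; nia.
Qed.

Lemma size_add_loop s st :
  size (add_loop st s).1.1 = size st.1.1 - size s /\
  size (add_loop st s).2 = size st.2 + size s.
Proof.
rewrite /add_loop; elim: s st => [|b s IH] [[y c] o] /=; first by split; lia.
by have [-> ->] := IH (add_step (y, c, o) b); rewrite /= size_behead; split; lia.
Qed.

Lemma bval_add x y : bval (add_bits x y) = bval x + bval y.
Proof.
rewrite /add_bits /add_out rev_cons bval_rcons size_rev /add_flush.
have /= := add_loopP x (y, false, [::]).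
rewrite expn0; case: (add_loop _ x) => [[y' c] o] /= E.
(* In the second loop the other summand is empty and stays so; only the carry is left to be
   output. *)
have := add_loopP y' ([::], c, o); have [/=] := size_add_loop y' ([::], c, o).
case: (add_loop _ y') => [[y2 c2] o2] /= /size0nil -> _ /=.
by move: E; set p := 2 ^ _; set q := 2 ^ _; nia.
Qed.

Lemma size_add x y : size (add_bits x y) <= (maxn (size x) (size y)).+1.
Proof.
rewrite /add_bits /add_out size_rev /add_flush /= ltnS.
have [/= h1 h2] := size_add_loop x (y, false, [::]).
have [_ ->] := size_add_loop (add_loop (y, false, [::]) x).1.1
  ([::], (add_loop (y, false, [::]) x).1.2, (add_loop (y, false, [::]) x).2).
by rewrite /= h1 h2; lia.
Qed.

(** Horner's scheme from the most significant bit of [x]; putting [false] in front doubles the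
    accumulator. *)
Definition mul_bits (x y : seq bool) : seq bool :=
  foldl (fun a b => add_bits (false :: a) (if b then y else [::])) [::] (rev x).

Lemma ptime_mul_bits {X} `{encoding X} (D : X -> Prop) f g :
  ptime D f -> ptime D g -> ptime D (fun x => mul_bits (f x) (g x)).
Proof.
apply: ptime_app2; rewrite /mul_bits.
apply: (ptime_foldl_measure (g := fun (z : seq bool * seq bool) a b =>
    add_bits (false :: a) (if b then z.2 else [::])) (c := 4) (k := 1)
    (mu := fun s : seq bool => size s)) => //.
- exact: esize_bits_le.
- by move=> s; have := size_bits_lt s; lia.
- move=> [x y] a b; apply: leq_trans (size_add _ _) _; rewrite /= expn1 !esize_pair /=.
  by have := size_bits_lt y; case: b => /=; lia.
- by ptime_tac.
- by ptime_tac.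
- by apply: ptime_add_bits; ptime_tac.
Qed.

Lemma mul_bits_cons b x y : mul_bits (b :: x) y =
  add_bits (false :: mul_bits x y) (if b then y else [::]).
Proof. by rewrite /mul_bits !foldl_rev. Qed.

Lemma bval_mul x y : bval (mul_bits x y) = bval x * bval y.
Proof.
elim: x => //= b x IH; rewrite mul_bits_cons bval_add /= IH.
by case: b => /=; lia.
Qed.

Lemma size_mul x y : size (mul_bits x y) <= size y + (size x).*2.
Proof.
elim: x => //= b x IH; rewrite mul_bits_cons.
by apply: leq_trans (size_add _ _) _; case: b => /=; lia.
Qed.

(** Bits are read from the least significant one, so a later difference overrides the verdict so
    far. Bits of the second number left at the end are settled by [lt_flush]. *)
Definition lt_step (st : seq bool * bool) (b : bool) : seq bool * bool :=
  (behead st.1, if b then if head false st.1 then st.2 else false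
                else if head false st.1 then true else st.2).
Definition lt_flush (st : seq bool * bool) : bool :=
  foldl (fun r b : bool => if b then true else r) st.2 st.1.
Definition lt_bits (x y : seq bool) : bool :=
  lt_flush (foldl lt_step (y, false) x).

Lemma lt_bitsE x y : lt_bits x y = (bval x < bval y).
Proof.
have flushE s r : lt_flush (s, r) = (0 < bval s + r).
  rewrite /lt_flush /=; elim: s r => [|b s IH] r /=; first by case: r.
  by rewrite IH; case: b r => [] []; lia.
(* The flag decides ties: [r = true] turns the strict comparison into a large one. *)
suff loopE r : lt_flush (foldl lt_step (y, r) x) = (bval x < bval y + r).
  by rewrite /lt_bits loopE addn0.
elim: x y r => [|b x IH] y r; first exact: flushE.
rewrite /= {}/lt_step /= IH (bval_head y).
by case: b (head false y) r => [] [] [] /=; lia.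
Qed.

Lemma ptime_lt_bits {X} `{encoding X} (D : X -> Prop) f g :
  ptime D f -> ptime D g -> ptime D (fun x => lt_bits (f x) (g x)).
Proof.
apply: ptime_app2; rewrite /lt_bits.
apply: (@ptime_app1 _ _ _ _ _ _ lt_flush).
  rewrite /lt_flush; apply: (ptime_foldl_esize
    (g := fun _ r b => if b then true else r) (k := 1)) => //; try by ptime_tac.
  move=> x a b; rewrite expn1; have : esize (if b then true else a) <= 3.
    by case: b a => [] [].
  have : 0 < esize a by exact: esize_gt0.
  by lia.
apply: (ptime_foldl_esize (g := fun=> lt_step) (k := 1)) => //;
  try by rewrite /lt_step; ptime_tac.
move=> x [y r] b; rewrite /lt_step !esize_pair /= expn1.
have : esize (behead y) <= esize y by case: y => //= c y; rewrite esize_cons; lia.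
have : esize (if b then if head false y then r else false
                else if head false y then true else r) <= 3.
  by case: b (head false y) r => [] [] [].
have : 0 < esize r by exact: esize_gt0.
by lia.
Qed.

(** * The algorithm on adjacency matrices *)

Notation fraction := (seq bool * seq bool)%type.
Notation wmatrix := (seq (seq (option fraction))).

(** Written as a left fold to fall under [ptime_foldl_esize]; bits missing from the mask count as
    [false]. *)
Definition zipb {T} (l : seq T) (s : seq bool) : seq (T * bool) :=
  rev (foldl (fun st x => (behead st.1, (x, head false st.1) :: st.2))
    (s, [::]) l).2.

Lemma zipb_cons {T} (x : T) l s :
  zipb (x :: l) s = (x, head false s) :: zipb l (behead s).
Proof.
rewrite /zipb /=; set g := fun st y => _.
suff gE r t o : (foldl g (t, r ++ o) l).2 = (foldl g (t, r) l).2 ++ o.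
  by rewrite -[[:: _]]cat0s gE rev_cat.
elim: l r t o => //= y l IH r t o; exact: (IH (_ :: _)).
Qed.

Lemma zipb_map {I T} (f : I -> T) (g : I -> bool) r :
  zipb (map f r) (map g r) = [seq (f i, g i) | i <- r].
Proof. by elim: r => //= i r IH; rewrite zipb_cons /= IH. Qed.

Lemma zipb_fst {T} (l : seq T) s : map fst (zipb l s) = l.
Proof. by elim: l s => //= x l IH s; rewrite zipb_cons /= IH. Qed.

Lemma ptime_zipb {X T} `{encoding X} `{encoding T} (D : X -> Prop)
    (f : X -> seq T) g :
  ptime D f -> ptime D g -> ptime D (fun x => zipb (f x) (g x)).
Proof.
move=> hf hg; rewrite /zipb; apply: ptime_rev; apply: ptime_snd.
apply: (ptime_foldl_esize (g := fun _ st x =>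
  (behead st.1, (x, head false st.1) :: st.2)) (k := 2)) => //; try by ptime_tac.
move=> x [t o] y; rewrite !esize_pair /= esize_cons esize_pair /=.
have := esize_bool (head false t).
have : esize (behead t) <= esize t by case: t => //= c t; rewrite esize_cons; lia.
have x_gt0 : 0 < esize x by exact: esize_gt0.
have y_gt0 : 0 < esize y by exact: esize_gt0.
by rewrite expnS expn1; set a := esize x; set b := esize y; nia.
Qed.

(** * Sums and comparison of unreduced fractions *)

Definition qadd (q e : fraction) : fraction :=
  (add_bits (mul_bits e.2 q.1) (mul_bits e.1 q.2), mul_bits e.2 q.2).

Definition qlt (q e : fraction) : bool :=
  lt_bits (mul_bits q.1 e.2) (mul_bits e.1 q.2).

Definition oadd (q : fraction) (o : option fraction) : fraction :=
  if o is Some e then qadd q e else q.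

Definition row_sum (q : fraction) (row : seq (option fraction)) (s : seq bool) :=
  foldl (fun q e => if e.2 then oadd q e.1 else q) q (zipb row s).

(** The sum starts from 0/1 and meets each edge in both directions, so on graphs it computes twice
    the weight. *)
Definition wsum (M : wmatrix) (s : seq bool) : fraction :=
  foldl (fun q e => if e.2 then row_sum q e.1 s else q) ([::], [:: true])
    (zipb M s).

Definition fsize (q : fraction) : nat := maxn (size q.1) (size q.2).

Lemma fsize_le q : fsize q <= esize q.
Proof.
case: q => a b; rewrite /fsize esize_pair /=.
by have := size_bits_lt a; have := size_bits_lt b; lia.
Qed.

Lemma esize_fraction q : esize q <= 20 * (fsize q).+1.
Proof.
case: q => a b; rewrite /fsize esize_pair /=.
by have := esize_bits_le a; have := esize_bits_le b; lia.
Qed.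

(** [size_mul] charges the first factor twice and the second once. The accumulator [q] is always the
    second factor in [qadd], so growth depends on the summand alone. *)
Lemma fsize_qadd q e : fsize (qadd q e) <= fsize q + 2 * esize e.
Proof.
case: q e => [a b] [c d]; rewrite /fsize esize_pair /=.
have := size_bits_lt c; have := size_bits_lt d.
have := size_add (mul_bits d a) (mul_bits c b).
by have := size_mul d a; have := size_mul c b; have := size_mul d b; lia.
Qed.

Lemma fsize_oadd q o : fsize (oadd q o) <= fsize q + 2 * esize o.
Proof. by case: o => [e|] /=; [exact: fsize_qadd|lia]. Qed.

Lemma fsize_row_sum q row s : fsize (row_sum q row s) <= fsize q + 2 * esize row.
Proof.
rewrite /row_sum -{2}(zipb_fst row s).
elim: (zipb row s) q => [|[e b] l IH] q; first by rewrite /=; lia.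
rewrite /= esize_cons; apply: leq_trans (IH _) _.
case: b; last by lia.
by have := fsize_oadd q e; lia.
Qed.

Lemma ptime_oadd {X} `{encoding X} (D : X -> Prop) f g :
  ptime D f -> ptime D g -> ptime D (fun x => oadd (f x) (g x)).
Proof.
apply: ptime_app2; rewrite /oadd.
apply: (@ptime_omatch _ _ _ _ _ _ _ _ _ snd
  (fun z : fraction * option fraction => qadd z.1) fst); try by ptime_tac.
rewrite /qadd; apply: ptime_pair; last by apply: ptime_mul_bits; ptime_tac.
by apply: ptime_add_bits; apply: ptime_mul_bits; ptime_tac.
Qed.

Lemma ptime_qlt {X} `{encoding X} (D : X -> Prop) f g :
  ptime D f -> ptime D g -> ptime D (fun x => qlt (f x) (g x)).
Proof.
by move=> hf hg; apply: ptime_lt_bits; apply: ptime_mul_bits; ptime_tac.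
Qed.

Lemma ptime_row_sum {X} `{encoding X} (D : X -> Prop) f g h :
  ptime D f -> ptime D g -> ptime D h ->
  ptime D (fun x => row_sum (f x) (g x) (h x)).
Proof.
move=> hf hg hh; rewrite /row_sum.
apply: (ptime_foldl_measure (g := fun _ q e => if e.2 then oadd q e.1 else q)
  (c := 20) (k := 2) (mu := fsize)) => //.
- exact: esize_fraction.
- exact: fsize_le.
- move=> x q [e b]; rewrite esize_pair /=; have := fsize_oadd q e.
  rewrite expnS expn1; set a := esize e; case: b => /=; nia.
- by apply: ptime_zipb.
- by apply: ptime_if; [ptime_tac|apply: ptime_oadd; ptime_tac|ptime_tac].
Qed.

Lemma ptime_wsum {X} `{encoding X} (D : X -> Prop) f g :
  ptime D f -> ptime D g -> ptime D (fun x => wsum (f x) (g x)).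
Proof.
apply: ptime_app2; rewrite /wsum.
apply: (ptime_foldl_measure (g := fun (z : wmatrix * seq bool) q e =>
  if e.2 then row_sum q e.1 z.2 else q) (c := 20) (k := 2) (mu := fsize)) => //.
- exact: esize_fraction.
- exact: fsize_le.
- move=> x q [e b]; rewrite [esize (e, b)]esize_pair /=; have := fsize_row_sum q e x.2.
  rewrite expnS expn1; set a := esize e; case: b => /=; nia.
- by ptime_tac.
- by apply: ptime_zipb; ptime_tac.
- by apply: ptime_if; [ptime_tac|apply: ptime_row_sum; ptime_tac|ptime_tac].
Qed.

Definition cnt (s : seq bool) : seq bool :=
  foldl (fun c b => if b then add_bits c [:: true] else c) [::] s.

Lemma ptime_cnt {X} `{encoding X} (D : X -> Prop) f :
  ptime D f -> ptime D (fun x => cnt (f x)).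
Proof.
move=> hf; rewrite /cnt; apply: (ptime_foldl_measure (g := fun _ c b =>
  if b then add_bits c [:: true] else c) (c := 4) (k := 1)
  (mu := fun s : seq bool => size s)) => //.
- exact: esize_bits_le.
- by move=> s; have := size_bits_lt s; lia.
- move=> x a b; rewrite expn1; have := size_add a [:: true].
  by case: b => /=; lia.
- by ptime_tac.
- by apply: ptime_if; [ptime_tac|apply: ptime_add_bits; ptime_tac|ptime_tac].
Qed.

Lemma bval_cnt s : bval (cnt s) = count id s.
Proof.
rewrite /cnt; set g := fun c b => _.
suff gE c : bval (foldl g c s) = bval c + count id s by rewrite gE.
elim: s c => [|b s IH] c /=; first by rewrite addn0.
by rewrite IH /g; case: b => /=; rewrite ?bval_add /=; lia.
Qed.

(** * Heaviest candidate, pruning and padding *)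

Definition better (M : wmatrix) (s t : seq bool) : seq bool :=
  if qlt (wsum M t) (wsum M s) then s else t.

Definition argbest (M : wmatrix) (cs : seq (seq bool)) : seq bool :=
  foldl (better M) (head [::] cs) (behead cs).

Lemma ptime_argbest {X} `{encoding X} (D : X -> Prop) f g :
  ptime D f -> ptime D g -> ptime D (fun x => argbest (f x) (g x)).
Proof.
apply: ptime_app2; rewrite /argbest.
apply: (ptime_foldl_esize (g := fun z : wmatrix * seq (seq bool) => better z.1)
  (k := 1)) => //; try by ptime_tac.
- by move=> x s t; rewrite /better; case: ifP => _; rewrite expn1; lia.
- rewrite /better; apply: ptime_if; try by ptime_tac.
  by apply: ptime_qlt; apply: ptime_wsum; ptime_tac.
Qed.

Lemma argbest_mem M cs : cs != [::] -> argbest M cs \in cs.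
Proof.
case: cs => // c cs _; rewrite /argbest /=; elim: cs c => [|d cs IH] c /=.
  by rewrite mem_seq1.
have := IH (better M c d); rewrite !inE => /predU1P[->|->]; last by rewrite !orbT.
by rewrite /better; case: ifP; rewrite eqxx ?orbT.
Qed.

(** The step of a fold does not see the rest of its list, so the state carries the reversed prefix
    and the suffix, from which a mask with one bit cleared is assembled. *)
Definition cand_step (st : seq bool * seq bool * seq (seq bool)) (b : bool) :=
  (b :: st.1.1, behead st.1.2,
   if b then catrev st.1.1 (false :: behead st.1.2) :: st.2 else st.2).

Definition cands (s : seq bool) : seq (seq bool) :=
  (foldl cand_step ([::], s, [::]) s).2.

Lemma mem_cand_loop s1 s2 o c :
  c \in (foldl cand_step (rev s1, s2, o) s2).2 <->
  c \in o \/ exists u v, s2 = u ++ true :: v /\ c = s1 ++ u ++ false :: v.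
Proof.
elim: s2 s1 o => [|b s2 IH] s1 o /=.
  by split => [|[//|[[|??] [? [//]]]]]; left.
rewrite /cand_step /= -rev_rcons IH catrevE revK.
split=> [[|[u [v [-> ->]]]]|[co|[u [v]]]].
- case: b => [|co]; last by left.
  rewrite inE => /predU1P[->|co]; last by left.
  by right; exists [::], s2.
- by right; exists (b :: u), v; rewrite cat_rcons.
- by left; case: b; rewrite ?inE co ?orbT.
- case: u => [|a u] /= [[-> ->] ->]; first by left; rewrite inE eqxx.
  by right; exists u, v; rewrite cat_rcons.
Qed.

Lemma mem_cands s c : c \in cands s <->
  exists u v, s = u ++ true :: v /\ c = u ++ false :: v.
Proof. by rewrite (mem_cand_loop [::]); split=> [[]|] //; right. Qed.

(** A step adds a list built from the accumulator itself, so [ptime_foldl_measure] does not apply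
    and reachable states are bounded directly. *)
Lemma cand_loop_size s l : size l <= size s ->
  let st := foldl cand_step ([::], s, [::]) l in
  [/\ size st.1.1 <= size l, size st.1.2 <= size s &
      esize st.2 <= size l * (8 * esize s + 8) + 1].
Proof.
have szs := size_bits_lt s.
elim/last_ind: l => [|l b IH]; first by split.
rewrite size_rcons foldl_rcons => ls; move: IH => /(_ (ltnW ls)) /=.
case: (foldl _ _ _) => [[a t] o] /= [h1 h2 h3].
rewrite !size_behead; split; [lia|lia|].
rewrite mulSn; case: b; last by lia.
rewrite esize_cons.
have := esize_bits_le (catrev a (false :: behead t)).
by rewrite catrevE size_cat size_rev /= size_behead; lia.
Qed.

Lemma ptime_cands {X} `{encoding X} (D : X -> Prop) f :
  ptime D f -> ptime D (fun x => cands (f x)).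
Proof.
apply: ptime_app1; rewrite /cands; apply: ptime_snd.
apply: (ptime_foldl (E := everywhere) (g := fun=> cand_step)
  (p := fun n => n * (8 * n + 8) + (8 * n + 11))) => //; try by
    rewrite ?/cand_step; ptime_tac.
  by poly_bounded_tac.
move=> s l1 l2 _ /(congr1 size); rewrite size_cat => sE.
have szs := size_bits_lt s.
have := @cand_loop_size s l1; rewrite {1}sE leq_addr => /(_ isT) /=.
move: (foldl _ _ _) => [[a b] o] /= [h1 h2 h3].
rewrite !esize_pair /=; have := esize_bits_le a; have := esize_bits_le b.
have : size l1 * (8 * esize s + 8) <= esize s * (8 * esize s + 8).
  by rewrite leq_mul2r; apply/orP; right; lia.
by lia.
Qed.

Lemma size_argbest_cands M s : size (argbest M (cands s)) <= size s.
Proof.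
have [->|/(argbest_mem M)/mem_cands] := eqVneq (cands s) [::]; first by [].
by move=> [u [v [-> ->]]]; rewrite !size_cat.
Qed.

(** The mask [s] doubles as a step counter: it is at least as long as the number of vertices to
    remove. *)
Definition prune (M : wmatrix) (k s : seq bool) : seq bool :=
  foldl (fun t _ => if lt_bits k (cnt t) then argbest M (cands t) else t) s s.

Lemma ptime_prune {X} `{encoding X} (D : X -> Prop) f g h :
  ptime D f -> ptime D g -> ptime D h ->
  ptime D (fun x => prune (f x) (g x) (h x)).
Proof.
apply: ptime_app3; rewrite /prune.
apply: (ptime_foldl_measure (g := fun (z : wmatrix * seq bool * seq bool) t _ =>
    if lt_bits z.1.2 (cnt t) then argbest z.1.1 (cands t) else t)
  (c := 4) (k := 1) (mu := fun s : seq bool => size s)) => //; try by ptime_tac.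
- exact: esize_bits_le.
- by move=> s; have := size_bits_lt s; lia.
- move=> x t b; apply: leq_trans (leq_addr _ _).
  by case: ifP => // _; exact: size_argbest_cands.
- apply: ptime_if; last by ptime_tac.
    by apply: ptime_lt_bits; [ptime_tac|apply: ptime_cnt; ptime_tac].
  by apply: ptime_argbest; [ptime_tac|apply: ptime_cands; ptime_tac].
Qed.

(** The state holds the reversed output and the number of selected vertices, those still to be read
    included. *)
Definition pad_step (k : seq bool) (st : seq bool * seq bool) (b : bool) :=
  if b then (true :: st.1, st.2) else
  if lt_bits st.2 k then (true :: st.1, add_bits st.2 [:: true])
  else (false :: st.1, st.2).

Definition pad (k s : seq bool) : seq bool :=
  rev (foldl (pad_step k) ([::], cnt s) s).1.

Lemma ptime_pad {X} `{encoding X} (D : X -> Prop) f g :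
  ptime D f -> ptime D g -> ptime D (fun x => pad (f x) (g x)).
Proof.
apply: ptime_app2; rewrite /pad; apply: ptime_rev; apply: ptime_fst.
apply: (ptime_foldl_measure (g := fun z : seq bool * seq bool => pad_step z.1)
  (c := 20) (k := 1)
  (mu := fun st : seq bool * seq bool => size st.1 + size st.2)) => //.
- move=> [a b]; rewrite esize_pair /=.
  by have := esize_bits_le a; have := esize_bits_le b; lia.
- move=> [a b]; rewrite esize_pair /=.
  by have := size_bits_lt a; have := size_bits_lt b; lia.
- move=> x [a c] b; rewrite /pad_step expn1 /=.
  have /= := size_add c [:: true].
  have x_gt0 : 0 < esize x by exact: esize_gt0.
  have b_gt0 : 0 < esize b by exact: esize_gt0.
  by move: b_gt0; case: b => /=; last case: ifP => _ /=; lia.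
- by apply: ptime_pair; [ptime_tac|apply: ptime_cnt; ptime_tac].
- by ptime_tac.
- rewrite /pad_step; apply: ptime_if; try by ptime_tac.
  apply: ptime_if; last by ptime_tac.
    by apply: ptime_lt_bits; ptime_tac.
  by apply: ptime_pair; [ptime_tac|apply: ptime_add_bits; ptime_tac].
Qed.

Lemma padP k s : bval k <= size s ->
  [/\ size (pad k s) = size s, count id (pad k s) = maxn (bval k) (count id s)
    & forall i, nth false s i -> nth false (pad k s) i].
Proof.
(* Since [c] also counts the selected bits still in [s], the difference [bval c - count id s] is the
   number of those already output. *)
have loop : forall o c, exists r, [/\
    rev (foldl (pad_step k) (o, c) s).1 = rev o ++ r, size r = size s,
    count id s <= bval c -> count id r + (bval c - count id s) =
       maxn (bval c) (minn (bval k) (bval c - count id s + size s))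
  & forall i, nth false s i -> nth false r i].
  elim: s => [|b s IH] o c /=.
    exists [::]; rewrite cats0; split => //= _; lia.
  rewrite /pad_step; case: b => /=.
    have [r [-> sr cr nr]] := IH (true :: o) c; exists (true :: r).
    rewrite rev_cons cat_rcons /= sr; split => //; last by case.
    by move=> le_c; have := cr (ltnW le_c); lia.
  rewrite lt_bitsE; case: ifP => ck.
    have [r [-> sr cr nr]] := IH (true :: o) (add_bits c [:: true]).
    exists (true :: r); rewrite rev_cons cat_rcons /= sr; split => //; last by case.
    by move: cr (count_size id s); rewrite bval_add /=; lia.
  have [r [-> sr cr nr]] := IH (false :: o) c; exists (false :: r).
  rewrite rev_cons cat_rcons /= sr; split => //; last by case.
  by move=> le_c; have := cr le_c; lia.
have [r [rE sr cr nr]] := loop [::] (cnt s) => ks.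
rewrite /pad rE; split => //=.
by move: cr (count_size id s); rewrite bval_cnt => /(_ (leqnn _)); lia.
Qed.

Definition resize (M : wmatrix) (k s : seq bool) := pad k (prune M k s).

(** Vertices stay and only edges with both ends in [s] are erased, so masks keep their meaning in
    all rounds. *)
Definition del (M : wmatrix) (s : seq bool) : wmatrix :=
  [seq if rb.2 then [seq if eb.2 then None else eb.1 | eb <- zipb rb.1 s]
       else rb.1 | rb <- zipb M s].

Definition orv (s t : seq bool) : seq bool :=
  [seq if p.1 then true else p.2 | p <- zipb s t].

Lemma ptime_resize {X} `{encoding X} (D : X -> Prop) f g h :
  ptime D f -> ptime D g -> ptime D h ->
  ptime D (fun x => resize (f x) (g x) (h x)).
Proof. by move=> hf hg hh; apply: ptime_pad => //; apply: ptime_prune. Qed.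

Lemma ptime_del {X} `{encoding X} (D : X -> Prop) f g :
  ptime D f -> ptime D g -> ptime D (fun x => del (f x) (g x)).
Proof.
apply: ptime_app2; rewrite /del.
apply: (ptime_map (f := fun (z : wmatrix * seq bool) rb =>
  if rb.2 then [seq if eb.2 then None else eb.1 | eb <- zipb rb.1 z.2] else rb.1)).
  apply: ptime_if; try by ptime_tac.
  apply: (ptime_map (f := fun _ (eb : option fraction * bool) =>
    if eb.2 then None else eb.1)).
    by ptime_tac.
  by apply: ptime_zipb; ptime_tac.
by apply: ptime_zipb; ptime_tac.
Qed.

Lemma ptime_orv {X} `{encoding X} (D : X -> Prop) f g :
  ptime D f -> ptime D g -> ptime D (fun x => orv (f x) (g x)).
Proof.
move=> hf hg; rewrite /orv.
apply: (ptime_map (f := fun _ (p : bool * bool) => if p.1 then true else p.2)).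
  by ptime_tac.
by apply: ptime_zipb; ptime_tac.
Qed.

(** A unary counter with one item per matrix entry, which gives [n ^ 2] rounds. *)
Definition fuel (M : wmatrix) : seq bool :=
  foldl (fun a row => foldl (fun a _ => true :: a) a row) [::] M.

Lemma esize_fuel_row (a : seq bool) (row : seq (option fraction)) :
  esize (foldl (fun a _ => true :: a) a row) <= esize a + 4 * esize row.
Proof.
elim: row a => [|e row IH] a /=; first by lia.
by apply: leq_trans (IH _) _; rewrite !esize_cons; move: (esize_bool true); lia.
Qed.

Lemma ptime_fuel {X} `{encoding X} (D : X -> Prop) f :
  ptime D f -> ptime D (fun x => fuel (f x)).
Proof.
move=> hf; rewrite /fuel.
apply: (ptime_foldl_esize (g := fun _ a row => foldl (fun a _ => true :: a) a row)
  (k := 2)) => //; try by ptime_tac.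
- move=> x a row; apply: leq_trans (esize_fuel_row a row) _.
  by rewrite leq_add2l expnS expn1; nia.
- apply: (ptime_foldl_esize (g := fun _ a _ => true :: a) (k := 2)) => //;
    try by ptime_tac.
  move=> x a e; rewrite esize_cons expnS expn1.
  by move: (esize_bool true); nia.
Qed.

(** * Correctness on graphs *)

Local Open Scope ring_scope.

(** Lets [ring] match both sides of a goal with an inequality already at hand. *)
Lemma ler_congr (F : numDomainType) (x y x' y' : F) :
  x = x' -> y = y' -> x' <= y' -> x <= y.
Proof. by move=> -> ->. Qed.

Definition fval (q : fraction) : rat := (bval q.1)%:R / (bval q.2)%:R.
Definition oval (o : option fraction) : rat := if o is Some q then fval q else 0.
Definition ogood (o : option fraction) : bool :=
  if o is Some q then (0 < bval q.2)%N else true.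

Lemma qaddP q e : (0 < bval q.2)%N -> (0 < bval e.2)%N ->
  (0 < bval (qadd q e).2)%N /\ fval (qadd q e) = fval q + fval e.
Proof.
move=> q0 e0; rewrite /fval /qadd /= bval_add !bval_mul muln_gt0 q0 e0; split => //.
rewrite natrD !natrM; field.
by rewrite !pnatr_eq0 -!lt0n q0 e0.
Qed.

Lemma qltE q e : (0 < bval q.2)%N -> (0 < bval e.2)%N ->
  qlt q e = (fval q < fval e).
Proof.
move=> q0 e0; rewrite /qlt lt_bitsE !bval_mul /fval.
by rewrite ltr_pdivrMr ?ltr0n // mulrAC ltr_pdivlMr ?ltr0n // -!natrM ltr_nat.
Qed.

(** * Vertex sets as characteristic vectors *)

Definition vec (n : nat) (S : {set 'I_n}) : seq bool :=
  [seq i \in S | i <- enum 'I_n].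

Lemma size_vec n (S : {set 'I_n}) : size (vec S) = n.
Proof. by rewrite size_map size_enum_ord. Qed.

Lemma nth_vec n (S : {set 'I_n}) (i : 'I_n) : nth false (vec S) i = (i \in S).
Proof. by rewrite (nth_map i) ?size_enum_ord // nth_ord_enum. Qed.

Lemma vec_nth n s : size s = n -> vec [set i : 'I_n | nth false s i] = s.
Proof.
move=> sn; apply: (@eq_from_nth _ false) => [|i]; rewrite size_vec // => ltin.
by rewrite -[i]/(nat_of_ord (Ordinal ltin)) nth_vec inE.
Qed.

Lemma vec_inj n : injective (@vec n).
Proof. by move=> S T ST; apply/setP => i; rewrite -!nth_vec ST. Qed.

Lemma count_vec n (S : {set 'I_n}) : count id (vec S) = #|S|.
Proof.
by rewrite /vec count_map cardE enumT -size_filter /enum_mem.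
Qed.

Lemma orv_vec n (S T : {set 'I_n}) : orv (vec S) (vec T) = vec (S :|: T).
Proof.
rewrite /orv zipb_map -map_comp; apply: eq_map => i /=.
by rewrite inE; case: (i \in S).
Qed.

Lemma mem_cands_vec n (S : {set 'I_n}) c :
  c \in cands (vec S) <-> exists2 i, i \in S & c = vec (S :\ i).
Proof.
rewrite mem_cands; split=> [[u [v [SE ->]]]|[i iS ->]].
  have ltun : (size u < n)%N.
    by rewrite -(size_vec S) SE size_cat /= addnS ltnS leq_addr.
  exists (Ordinal ltun).
    by rewrite -nth_vec SE /= nth_cat ltnn subnn.
  apply: (@eq_from_nth _ false) => [|j].
    by rewrite size_vec -(size_vec S) SE !size_cat.
  move=> jlt; have ltjn : (j < n)%N by rewrite -(size_vec S) SE !size_cat in jlt *.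
  rewrite -[in RHS](_ : nat_of_ord (Ordinal ltjn) = j) // nth_vec !inE -nth_vec SE.
  rewrite -val_eqE /= !nth_cat; case: ltngtP => [||->] //=; last by rewrite subnn.
  by rewrite -subn_gt0; case: (j - size u)%N.
exists (take i (vec S)), (drop i.+1 (vec S)).
have lti : (i < size (vec S))%N by rewrite size_vec.
have := iS; rewrite -nth_vec => iS'; split.
  by rewrite -[true]iS' -drop_nth // cat_take_drop.
apply: (@eq_from_nth _ false) => [|j].
  by rewrite size_cat size_take /= size_drop !size_vec ltn_ord; have := ltn_ord i; lia.
rewrite size_vec => ltjn.
rewrite -[in LHS](_ : nat_of_ord (Ordinal ltjn) = j) // nth_vec !inE -nth_vec /=.
rewrite -val_eqE /= nth_cat size_take lti.
case: ltngtP => [ji|ij|->] /=; last by rewrite subnn.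
  by rewrite nth_take.
have [d ->] : exists d, j = (i.+1 + d)%N by exists (j - i.+1)%N; lia.
by rewrite addSn -addnS addKn /= nth_drop addSn addnS.
Qed.

(** * Weight inside a vertex set, and what resizing preserves of it *)

Section Weights.
Variable G : wgraph.
Implicit Types S T : {set vertex G}.

Definition wt (i j : vertex G) : rat := if edge i j then weight i j else 0.

(* Every edge is counted twice. *)
Definition dweight S : rat := \sum_(i in S) \sum_(j in S) wt i j.

Definition mat : wmatrix :=
  [seq [seq (if edge i j then Some (bits `|numq (weight i j)|%N,
                                    bits `|denq (weight i j)|%N) else None)
       | j <- enum (vertex G)] | i <- enum (vertex G)].

Lemma wt_ge0 i j : 0 <= wt i j.
Proof. by rewrite /wt; case: ifP => // /weight_gt0/ltW. Qed.

Lemma wt_sym i j : wt i j = wt j i.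
Proof. by rewrite /wt edge_sym; case: ifP => // ij; rewrite -weight_sym // edge_sym. Qed.

Lemma wt_diag i : wt i i = 0.
Proof. by rewrite /wt edge_irr. Qed.

Lemma dweight_ge0 S : 0 <= dweight S.
Proof. by do 2 apply: sumr_ge0 => ? _; exact: wt_ge0. Qed.

(** With indicators, all sums range over the same pairs and can be compared term by term. *)
Lemma dweightE S : dweight S = \sum_i \sum_j (i \in S)%:R * (j \in S)%:R * wt i j.
Proof.
rewrite /dweight big_mkcond; apply: eq_bigr => i _.
case: (i \in S); last by rewrite big1 // => j _; rewrite !mul0r.
rewrite big_mkcond; apply: eq_bigr => j _.
by case: (j \in S); rewrite ?mul0r ?mulr0 ?mul0r // !mul1r.
Qed.

Lemma dweight_sub S T : S \subset T -> dweight S <= dweight T.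
Proof.
move=> /subsetP ST; rewrite !dweightE; apply: ler_sum => i _; apply: ler_sum => j _.
rewrite ler_wpM2r ?wt_ge0 // -!natrM ler_nat leq_mul //.
- by have := ST i; case: (i \in S) => // ->.
- by have := ST j; case: (j \in S) => // ->.
Qed.

Lemma total_weightE S : total_weight S *+ 2 = dweight S.
Proof.
have ltE (P : rel 'I_(nverts G)) : \sum_(i in S) \sum_(j in S | edge i j && P i j)
    weight i j = \sum_(i in S) \sum_(j in S) (P i j)%:R * wt i j.
  apply: eq_bigr => i _; rewrite big_mkcondr; apply: eq_bigr => j _.
  by rewrite /wt; case: edge; case: (P i j); rewrite /= ?mul1r ?mul0r.
rewrite /total_weight (ltE (fun i j => (i < j)%N)) mulr2n.
rewrite [X in _ + X]exchange_big /= -big_split; apply: eq_bigr => i _ /=.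
rewrite -big_split; apply: eq_bigr => j _ /=; rewrite (wt_sym j i) -mulrDl -natrD.
have [_|_|/val_inj ->] := ltngtP i j; rewrite ?mul1r //.
by rewrite wt_diag mulr0.
Qed.

Lemma densityE S : density S = dweight S / (2 * #|S|%:R).
Proof.
by rewrite /density -total_weightE -[_ *+ 2]mulr_natl -mulf_div divff // mul1r.
Qed.

Lemma row_sum_vec q (f : vertex G -> option fraction) S :
  (0 < bval q.2)%N -> (forall j, ogood (f j)) ->
  (0 < bval (row_sum q (map f (enum (vertex G))) (vec S)).2)%N /\
  fval (row_sum q (map f (enum (vertex G))) (vec S)) =
    fval q + \sum_(j in S) oval (f j).
Proof.
move=> q0 fg; rewrite /row_sum zipb_map big_mkcond -[in X in _ + X]big_enum /=.
elim: (enum _) q q0 => [|i r IH] q q0 /=; first by rewrite big_nil addr0.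
rewrite big_cons; case: (i \in S) => /=; last by rewrite add0r; exact: IH.
have := fg i; case: (f i) => [e|] /=; last by rewrite add0r => _; exact: IH.
by move=> /(qaddP q0)[h1 h2]; have [? ->] := IH _ h1; rewrite h2 addrA.
Qed.

(** Edge weights are positive, so taking absolute values of numerators loses nothing. *)
Lemma ogood_entry (i j : vertex G) :
  let o := if edge i j then Some (bits `|numq (weight i j)|%N,
                                  bits `|denq (weight i j)|%N) else None in
  ogood o /\ oval o = wt i j.
Proof.
rewrite /wt; case: ifP => //= ij; rewrite bval_bits absz_gt0 denq_neq0; split => //.
rewrite /fval /= !bval_bits -[in RHS](divq_num_den (weight i j)).
by rewrite !pmulrn !gez0_abs // ?ltW ?denq_gt0 ?numq_gt0 ?weight_gt0.
Qed.

Lemma wsum_vec S : (0 < bval (wsum mat (vec S)).2)%N /\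
  fval (wsum mat (vec S)) = dweight S.
Proof.
pose row i := [seq (if edge i j then Some (bits `|numq (weight i j)|%N,
    bits `|denq (weight i j)|%N) else None) | j <- enum (vertex G)].
rewrite /wsum -[mat]/(map row (enum (vertex G))) zipb_map /dweight.
rewrite big_mkcond -[in X in _ = X]big_enum /=.
rewrite -[X in _ /\ _ = X]add0r.
rewrite -[X in _ /\ _ = X + _](_ : fval ([::], [:: true]) = 0); last first.
  by rewrite /fval /= mul0r.
have : (0 < bval ([::] : seq bool, [:: true]).2)%N by [].
move: ([::], [:: true]) => q.
elim: (enum _) q => [|i r IH] q q0 /=; first by rewrite big_nil addr0.
rewrite big_cons; case: (i \in S) => /=; last by rewrite add0r; exact: IH.
have [h1 h2] := row_sum_vec S q0 (fun j => (ogood_entry i j).1).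
have [h3 ->] := IH _ h1; split => //; rewrite h2 addrA; congr (_ + _ + _).
by apply: eq_bigr => j _; exact: (ogood_entry i j).2.
Qed.

Lemma argbest_max (cs : seq {set vertex G}) : cs != [::] ->
  exists2 S, S \in cs & argbest mat (map (@vec _) cs) = vec S /\
    forall T, T \in cs -> dweight T <= dweight S.
Proof.
case: cs => // S0 cs _; rewrite /argbest /=.
elim: cs S0 => [|T cs IH] S0 /=.
  by exists S0; rewrite ?mem_head //; split=> // T; rewrite inE => /eqP ->.
have [S0g S0E] := wsum_vec S0; have [Tg TE] := wsum_vec T.
have -> : better mat (vec S0) (vec T) =
    vec (if dweight T < dweight S0 then S0 else T).
  by rewrite /better qltE // S0E TE; case: ifP.
set B := if _ then _ else _.
have B0 : dweight S0 <= dweight B /\ dweight T <= dweight B.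
  by rewrite /B; case: ltP => // /ltW.
have [S SB [-> Smax]] := IH B; exists S.
  move: SB; rewrite !inE => /predU1P[->|->]; last by rewrite !orbT.
  by rewrite /B; case: ifP; rewrite eqxx ?orbT.
split => // U; have BS := Smax B (mem_head _ _).
rewrite !inE => /or3P[/eqP->|/eqP->|Ucs].
- exact: le_trans B0.1 BS.
- exact: le_trans B0.2 BS.
- by apply: Smax; rewrite inE Ucs orbT.
Qed.

Lemma dweight_rem S i : i \in S ->
  dweight (S :\ i) = dweight S - (\sum_(j in S) wt i j) *+ 2.
Proof.
move=> iS; have rowE k : \sum_(j in S) wt k j =
    wt k i + \sum_(j in S :\ i) wt k j by rewrite (big_setD1 i).
have colE : \sum_(k in S :\ i) \sum_(j in S) wt k j =
    \sum_(k in S :\ i) wt i k + dweight (S :\ i).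
  by rewrite -big_split; apply: eq_bigr => k _; rewrite rowE (wt_sym k).
rewrite [dweight S]/dweight (big_setD1 i) //= colE rowE wt_diag add0r.
by ring.
Qed.

(** Double counting: an edge inside [S] survives the removal of every vertex except its two ends. *)
Lemma sum_dweight_rem S :
  \sum_(i in S) dweight (S :\ i) = (#|S|%:R - 2) * dweight S.
Proof.
rewrite (eq_bigr (fun i => dweight S - (\sum_(j in S) wt i j) *+ 2)) => [|i];
  last exact: dweight_rem.
by rewrite sumrB sumr_const sumrMnl -/(dweight S) -[_ *+ #|S|]mulr_natl; ring.
Qed.

(** The best removal is at least as good as the average one, given by [sum_dweight_rem]. *)
Lemma argbest_cands S : S != set0 -> exists2 T : {set vertex G},
  argbest mat (cands (vec S)) = vec T &
  #|T| = #|S|.-1 /\ (#|S|%:R - 2) * dweight S <= #|S|%:R * dweight T.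
Proof.
move=> S0; pose cs := [seq [set i : vertex G | nth false c i] | c <- cands (vec S)].
have csE : cands (vec S) = map (@vec _) cs.
  rewrite -map_comp -[LHS]map_id; apply/eq_in_map => c /mem_cands_vec[i _ ->] /=.
  by rewrite vec_nth // size_vec.
have csP T : T \in cs <-> exists2 i, i \in S & T = S :\ i.
  rewrite -(mem_map (@vec_inj _)) -csE mem_cands_vec.
  by split=> -[i iS]; [move/vec_inj|move=> ->]; exists i.
have [i0 i0S] := set0Pn _ S0.
have cs0 : cs != [::].
  have : S :\ i0 \in cs by apply/csP; exists i0.
  by case: (cs).
have [T /csP[i iS TE] [bE bmax]] := argbest_max cs0.
exists T; first by rewrite csE.
split; first by rewrite TE [in RHS](cardsD1 i) iS.
rewrite -sum_dweight_rem mulr_natl -sumr_const.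
by apply: ler_sum => j jS; apply: bmax; apply/csP; exists j.
Qed.

(** A removal from [m] vertices keeps a fraction at least [(m - 2) / m] of the weight, and these
    fractions telescope. The result is multiplied out so that no denominator can vanish. *)
Lemma pruneP (k : nat) S : exists2 T : {set vertex G},
  prune mat (bits k) (vec S) = vec T &
  if (#|S| <= k)%N then T = S else
  #|T| = k /\ dweight S * (k * k.-1)%:R <= dweight T * (#|S| * #|S|.-1)%:R.
Proof.
pose g t (_ : bool) :=
  if lt_bits (bits k) (cnt t) then argbest mat (cands t) else t.
rewrite -[prune _ _ _]/(foldl g (vec S) (vec S)).
(* The list folded over only counts iterations; the induction needs it to cover the excess of [#|S|]
   over [k]. *)
have : (#|S| <= k + size (vec S))%N.
  rewrite size_vec; apply: leq_trans (leq_addl _ _).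
  by apply: leq_trans (max_card _) _; rewrite card_ord.
move: {1 3}(vec S) => r; elim: r S => [|b r IH] S /=.
  by rewrite addn0 => Sk; exists S => //; rewrite Sk.
move=> Sr; have Skr : (#|S| <= k + (size r).+1)%N := Sr.
have -> : g (vec S) b = if (#|S| <= k)%N then vec S else
    argbest mat (cands (vec S)).
  by rewrite /g lt_bitsE bval_bits bval_cnt count_vec; case: leqP.
case: leqP => [Sk|kS].
  have [|T ->] := IH S; first by rewrite (leq_trans Sk) ?leq_addr.
  by rewrite Sk; exists T.
have [|T0 -> [T0S T0w]] := @argbest_cands S.
  by rewrite -card_gt0; apply: leq_trans kS.
have [|T -> HT] := IH T0; first by rewrite T0S; lia.
exists T => //; move: HT; case: leqP => [T0k ->|kT0 [-> HT]].
  have kE : #|T0| = k by lia.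
  split=> //; rewrite -kE T0S; have S0 : (0 < #|S|)%N by lia.
  have [s1|S2] := leqP #|S| 1.
    have -> : #|S|.-1 = 0%N by lia.
    by rewrite !mul0n muln0 !mulr0.
  have -> : (#|S|.-1 * #|S|.-2)%:R = #|S|.-1%:R * (#|S|%:R - 2) :> rat.
    by rewrite natrM -natrB //; congr (_ * _%:R); lia.
  rewrite [in X in _ <= X]natrM.
  by apply: (ler_congr _ _ (ler_wpM2l (ler0n rat #|S|.-1) T0w)); ring.
split=> //; move: HT T0w; rewrite T0S.
(* For [#|S| <= 2] the factor [#|S| - 2] cannot be cancelled, but then [k = 0] and the left side
   vanishes. *)
have [S2|S2] := leqP #|S| 2.
  have -> : (k * k.-1 = 0)%N by lia.
  by move=> _ _; rewrite mulr0 mulr_ge0 ?dweight_ge0.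
have -> : (#|S|.-1 * #|S|.-2)%:R = #|S|.-1%:R * (#|S|%:R - 2) :> rat.
  by rewrite natrM -natrB; [congr (_ * _%:R)|]; lia.
rewrite [in X in _ -> _ -> _ <= X]natrM.
have : (0 : rat) < #|S|%:R - 2 by rewrite subr_gt0 ltr_nat.
have : (0 : rat) <= #|S|%:R by [].
have : (0 : rat) <= (k * k.-1)%:R by [].
have := dweight_ge0 S; have := dweight_ge0 T; have := dweight_ge0 T0.
move: (dweight T0) (dweight T) (dweight S) => t0 t s.
move: (#|S|%:R) (#|S|.-1%:R) ((k * k.-1)%:R) => m m1 kk t00 tt0 s0 kk0 m0 m2 h1 h2.
rewrite -(ler_pM2l m2).
apply: (@le_trans _ _ (m * t0 * kk)).
  by rewrite mulrA; apply: ler_wpM2r.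
by apply: (ler_congr _ _ (ler_wpM2l m0 h1)); ring.
Qed.

Lemma resizeP (k : nat) S : (k <= nverts G)%N -> exists2 T : {set vertex G},
  resize mat (bits k) (vec S) = vec T &
  #|T| = k /\ if (#|S| <= k)%N then dweight S <= dweight T else
    dweight S * (k * k.-1)%:R <= dweight T * (#|S| * #|S|.-1)%:R.
Proof.
move=> kn; rewrite /resize; have [T0 -> HT0] := pruneP k S.
have [|sz ct nth_le] := @padP (bits k) (vec T0); first by rewrite bval_bits size_vec.
rewrite size_vec in sz; rewrite bval_bits count_vec in ct.
set T := [set i : vertex G | nth false (pad (bits k) (vec T0)) i].
have TE : vec T = pad (bits k) (vec T0) by exact: vec_nth.
have cT : #|T| = maxn k #|T0| by rewrite -ct -TE count_vec.
have T0T : dweight T0 <= dweight T.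
  by apply/dweight_sub/subsetP => i iT0; rewrite inE nth_le // nth_vec.
exists T => //; move: HT0; rewrite cT; case: ifP => [Sk T0S|_ [T0k HT0]].
  by rewrite T0S in T0T *; split => //; lia.
rewrite T0k maxnn; split => //; apply: le_trans HT0 _.
by rewrite ler_wpM2r.
Qed.

End Weights.

(** * Deleting the edges inside the sets returned so far, latest set first *)

Section Removal.
Variable G : wgraph.
Implicit Types (S X : {set vertex G}) (L : seq {set vertex G}).

Definition keep L (i j : vertex G) : bool :=
  all (fun S : {set vertex G} => ~~ ((i \in S) && (j \in S))) L.

Lemma keep_sym L i j : keep L i j = keep L j i.
Proof. by apply: eq_all => S; rewrite andbC. Qed.

Definition sub_edge L : rel (vertex G) := fun i j => edge i j && keep L i j.

Lemma sub_edge_sym L : symmetric (sub_edge L).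
Proof. by move=> i j; rewrite /sub_edge edge_sym keep_sym. Qed.

Lemma sub_edge_irr L : irreflexive (sub_edge L).
Proof. by move=> i; rewrite /sub_edge edge_irr. Qed.

Lemma sub_weight_sym L i j : sub_edge L i j -> weight i j = weight j i.
Proof. by move=> /andP[/weight_sym]. Qed.

Lemma sub_weight_gt0 L i j : sub_edge L i j -> 0 < weight i j.
Proof. by move=> /andP[/weight_gt0]. Qed.

(** The vertex type is unchanged by conversion, so a set of vertices of [G] is also one of
    [sub L]. *)
Definition sub L : wgraph := WGraph (sub_edge_sym L) (sub_edge_irr L)
  (@sub_weight_sym L) (@sub_weight_gt0 L).

Definition subweight L X : rat := @dweight (sub L) X.

Lemma subweightE L X : subweight L X =
  \sum_i \sum_j (i \in X)%:R * (j \in X)%:R * ((keep L i j)%:R * wt i j).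
Proof.
rewrite /subweight dweightE; apply: eq_bigr => i _; apply: eq_bigr => j _.
congr (_ * _); rewrite /wt /= /sub_edge.
by case: edge; case: keep; rewrite /= ?mul1r ?mul0r ?mulr0.
Qed.

Lemma subweight_nil X : subweight [::] X = dweight X.
Proof.
by rewrite subweightE dweightE; do 2 apply: eq_bigr => ? _; rewrite mul1r.
Qed.

Lemma subweight_cons S L X :
  subweight (S :: L) X = subweight L X - subweight L (X :&: S).
Proof.
rewrite !subweightE -sumrB; apply: eq_bigr => i _.
rewrite -sumrB; apply: eq_bigr => j _; rewrite /= !inE.
by case: (i \in X); case: (j \in X); case: (i \in S); case: (j \in S);
  case: (keep L i j); rewrite /= ?(mul0r, mulr0, mul1r, subrr, subr0).
Qed.

Definition cov L : {set vertex G} := foldr (fun S V => V :|: S) set0 L.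

(** The unions after each round, latest first; the empty union before the first round is left
    out. *)
Fixpoint covs L : seq {set vertex G} :=
  if L is _ :: L' then cov L :: covs L' else [::].

Lemma not_keep L i j : ~~ keep L i j -> (i \in cov L) && (j \in cov L).
Proof.
elim: L => //= S L IH; rewrite negb_and negbK !inE.
by case/orP => [/andP[-> ->]|/IH/andP[-> ->]]; rewrite ?orbT.
Qed.

(** A deleted edge has both ends in one of the sets, hence in their union. Applied both to the
    optimal set and to the whole graph. *)
Lemma subweight_removed L X : dweight X - subweight L X <= dweight (cov L).
Proof.
rewrite !dweightE subweightE -sumrB; apply: ler_sum => i _.
rewrite -sumrB; apply: ler_sum => j _.
have [_|/not_keep/andP[-> ->]] := boolP (keep L i j).
  by rewrite mul1r subrr !mulr_ge0 ?wt_ge0.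
rewrite !mul0r mulr0 subr0 !mul1r -natrM -[X in _ <= X]mul1r ler_wpM2r ?wt_ge0 //.
by rewrite lern1; case: (i \in X); case: (j \in X).
Qed.

Definition nedges L : nat := #|[set p : vertex G * vertex G | sub_edge L p.1 p.2]|.

Lemma nedges_cons S L : 0 < subweight L S -> (nedges (S :: L) < nedges L)%N.
Proof.
move=> W0; have /existsP[i /existsP[j /and3P[iS jS ij]]] :
    [exists i, exists j, [&& i \in S, j \in S & sub_edge L i j]].
  apply: contraLR W0; rewrite negb_exists => /forallP no; rewrite -leNgt.
  rewrite /subweight /dweight big1 // => i iS; rewrite big1 // => j jS.
  have := no i; rewrite negb_exists => /forallP/(_ j).
  by rewrite iS jS /= /wt /= => /negbTE ->.
apply: proper_card; apply/properP; split.
  apply/subsetP => -[a b]; rewrite !inE /sub_edge /= => /and3P[-> _ ->] //.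
by exists (i, j); rewrite !inE //= /sub_edge /= iS jS andbF.
Qed.

(** Diagonal pairs are no edges, whence strictness: [nverts G * nverts G] rounds cannot all delete
    an edge. *)
Lemma nedges_lt : (0 < nverts G)%N -> (nedges [::] < nverts G * nverts G)%N.
Proof.
move=> n0; have -> : (nverts G * nverts G)%N = #|{: vertex G * vertex G}|.
  by rewrite card_prod card_ord.
apply: proper_card; apply/properP; split; first exact/subsetP.
by exists (Ordinal n0, Ordinal n0); rewrite ?inE //= /sub_edge edge_irr.
Qed.

Lemma mat_sub_nil : mat (sub [::]) = mat G.
Proof.
by apply: eq_map => i; apply: eq_map => j; rewrite /= /sub_edge andbT.
Qed.

Lemma del_mat S L : del (mat (sub L)) (vec S) = mat (sub (S :: L)).
Proof.
rewrite /del /mat zipb_map -map_comp; apply: eq_map => i /=.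
case: (boolP (i \in S)) => iS /=; last first.
  by apply: eq_map => j; rewrite /= /sub_edge /= (negbTE iS).
rewrite zipb_map -map_comp; apply: eq_map => j /=.
by rewrite /sub_edge /= iS; case: (j \in S); rewrite ?andbF.
Qed.

Lemma esize_seq_le {A B C} `{encoding A} `{encoding B} (f : C -> A) (g : C -> B) l :
  (forall i, (esize (f i) <= esize (g i))%N) ->
  (esize (map f l) <= esize (map g l))%N.
Proof.
by move=> fg; elim: l => //= i l IH; rewrite !esize_cons ltnS leq_add.
Qed.

(** Deletion replaces entries by [None], encoded by a single leaf, so no round sees a larger matrix
    than the input. *)
Lemma esize_mat_sub L : (esize (mat (sub L)) <= esize (mat G))%N.
Proof.
do 2 apply: esize_seq_le => ?; rewrite /= /sub_edge.
by case: edge => //=; case: keep => //; exact: esize_gt0.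
Qed.

Lemma esize_vec S : (esize (vec S) <= 4 * (nverts G).+1)%N.
Proof. by apply: leq_trans (esize_bits_le _) _; rewrite size_vec. Qed.

Lemma esize_covs L : (esize (map (@vec _) (covs L)) <=
  size L * (4 * (nverts G).+1 + 1) + 1)%N.
Proof.
elim: L => //= S L IH; rewrite esize_cons mulSn.
by have := esize_vec (cov L :|: S); lia.
Qed.

End Removal.

Lemma size_fuel_mat (G : wgraph) : size (fuel (mat G)) = (nverts G * nverts G)%N.
Proof.
have rowE (a : seq bool) (row : seq (option fraction)) :
    size (foldl (fun a _ => true :: a) a row) = (size a + size row)%N.
  by elim: row a => [|e row IH] a /=; rewrite ?addn0 // IH /= addSnnS.
have fuelE (M : wmatrix) (a : seq bool) :
    size (foldl (fun a row => foldl (fun a _ => true :: a) a row) a M) =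
    (size a + \sum_(row <- M) size row)%N.
  elim: M a => [|row M IH] a; first by rewrite big_nil addn0.
  by rewrite big_cons /= IH rowE addnA.
rewrite /fuel fuelE add0n /mat big_map big_enum /=.
under eq_bigr do rewrite size_map size_enum_ord.
by rewrite sum_nat_const card_ord.
Qed.

(** * The algorithm, for a function [f] standing for the given one *)

Section Rounds.
Variable f : wmatrix * seq bool -> seq bool.

Definition round (k : seq bool) (st : wmatrix * seq bool * seq (seq bool)) :=
  (del st.1.1 (f (st.1.1, k)), orv st.1.2 (f (st.1.1, k)),
   orv st.1.2 (f (st.1.1, k)) :: st.2).

Definition rounds (z : wmatrix * seq bool) (l : seq bool) :=
  foldl (fun st _ => round z.2 st) (z.1, [seq false | _ <- z.1], [::]) l.

(** Resizing and the final choice use the weights of the input graph, not those left after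
    deletions. *)
Definition dks (z : wmatrix * seq bool) : seq bool :=
  argbest z.1 [seq resize z.1 z.2 V | V <- (rounds z (fuel z.1)).2].

Variable post : forall G : wgraph, nat -> {set vertex G} -> Prop.
Arguments post : clear implicits.

(** A history of rounds: each set is a valid answer on the graph left by the earlier ones. *)
Fixpoint run (G : wgraph) (k : nat) (L : seq {set vertex G}) : Prop :=
  if L is V :: L' then post (sub L') k V /\ run k L' else True.

Hypothesis f_post : forall (G : wgraph) k, (0 < nverts G)%N -> (0 < k)%N ->
  exists2 S : {set vertex G}, f (mat G, bits k) = vec S & post G k S.

(** Every reachable state encodes a history, so [f] is always called on the matrix of a genuine
    graph, where [f_post] applies. *)
Lemma roundsP (G : wgraph) k l : (0 < nverts G)%N -> (0 < k)%N ->
  exists L : seq {set vertex G}, [/\ size L = size l, run k L &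
    rounds (mat G, bits k) l =
      (mat (sub L), vec (cov L), map (@vec _) (covs L))].
Proof.
move=> n0 k0; rewrite /rounds; elim/last_ind: l => [|l b [L [sL rL lE]]].
  exists [::]; split => //=; rewrite mat_sub_nil; congr (_, _, _).
  by rewrite /mat /vec -map_comp; apply: eq_map => i; rewrite inE.
rewrite foldl_rcons lE /round /=.
have [S SE pS] := @f_post (sub L) k n0 k0.
exists (S :: L); rewrite /= size_rcons sL; split => //.
by rewrite SE del_mat orv_vec.
Qed.

Definition call_dom (z : wmatrix * seq bool) : Prop :=
  exists (G : wgraph) k, [/\ (0 < nverts G)%N, (0 < k)%N & z = (mat G, bits k)].

Definition dks_dom (z : wmatrix * seq bool) : Prop :=
  exists (G : wgraph) k, (1 <= k <= nverts G)%N /\ z = (mat G, bits k).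

(** [f] is polynomial on [call_dom] only; [roundsP] shows that reachable states stay there and are
    small. *)
Lemma ptime_dks : ptime call_dom f -> ptime dks_dom dks.
Proof.
move=> hf; rewrite /dks; apply: ptime_argbest; first by ptime_tac.
apply: ptime_map; first by apply: ptime_resize; ptime_tac.
apply: ptime_snd; rewrite /rounds.
pose E (z : wmatrix * seq bool * (wmatrix * seq bool * seq (seq bool)) * bool) :=
  call_dom (z.1.2.1.1, z.1.1.2).
(* The terms of [p] bound the current matrix, the mask of the union, the list of at most [n * n]
   unions, and the pairing nodes. *)
apply: (ptime_foldl (E := E)
  (g := fun (z : wmatrix * seq bool) st (_ : bool) => round z.2 st)
  (p := fun n => n + 4 * (n + 1) + (n * n * (4 * (n + 1) + 1) + 1) + 2)%N).
- apply: ptime_pair; last by ptime_tac.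
  apply: ptime_pair; first by ptime_tac.
  by apply: (ptime_map (f := fun _ _ => false)); ptime_tac.
- by apply: ptime_fuel; ptime_tac.
- have fE : ptime E (fun z => f (z.1.2.1.1, z.1.1.2)).
    apply: (ptime_comp hf); last by move=> z; exact.
    by ptime_tac.
  have oE : ptime E (fun z => orv z.1.2.1.2 (f (z.1.2.1.1, z.1.1.2))).
    by apply: ptime_orv => //; ptime_tac.
  rewrite /round; apply: ptime_pair; last by apply: ptime_cons => //; ptime_tac.
  by apply: ptime_pair => //; apply: ptime_del => //; ptime_tac.
- move=> _ l1 b l2 [G [k [/andP[k0 kn] ->]]] _.
  have n0 := leq_trans k0 kn.
  have [L [_ _ lE]] := roundsP l1 n0 k0; rewrite /rounds in lE.
  by rewrite /E lE; exists (sub L), k.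
- by poly_bounded_tac.
- move=> _ l1 l2 [G [k [/andP[k0 kn] ->]]] /(congr1 size).
  rewrite size_fuel_mat size_cat => sl.
  have n0 := leq_trans k0 kn.
  have [L [sL _ lE]] := roundsP l1 n0 k0; rewrite /rounds in lE; rewrite lE.
  rewrite !esize_pair /=.
  have := esize_mat_sub L; have := esize_vec (cov L); have := esize_covs L.
  have nM : (nverts G <= esize (mat G))%N.
    by apply: leq_trans (ltnW (size_esize _)); rewrite size_map size_enum_ord.
  set n := ((esize (mat G) + esize (bits k)).+1).
  have nn : (nverts G <= n)%N by rewrite /n; lia.
  have Mn : (esize (mat G) <= n)%N by rewrite /n; lia.
  have sLn : (size L * (4 * (nverts G).+1 + 1) <= n * n * (4 * (n + 1) + 1))%N.
    by rewrite leq_mul //; [rewrite sL; nia|lia].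
  by lia.
Qed.

End Rounds.

(** * The approximation guarantee *)

Lemma dam_ge (G : wgraph) k (S : {set vertex G}) :
  S != set0 -> (#|S| <= k)%N -> density S <= dam G k.
Proof.
by move=> S0 Sk; rewrite /dam; apply: (le_bigmax_cond _ (@density G)); rewrite S0.
Qed.

(** The first alternative covers the default value of the maximum. *)
Lemma dk_attained (G : wgraph) k :
  dk G k = 0 \/ exists2 H : {set vertex G}, #|H| = k & dk G k = density H.
Proof.
rewrite /dk; elim/big_ind: _; first by left.
- by move=> x y hx hy; case: leP.
- by move=> S /eqP Sk; right; exists S.
Qed.

Section Analysis.
Variables (R : realType) (beta gamma : R).
Hypotheses (beta_ge1 : 1 <= beta) (gamma_ge1 : 1 <= gamma).

Definition dam_post (G : wgraph) (k : nat) (S : {set vertex G}) : Prop :=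
  [/\ S != set0, #|S|%:R <= beta * k%:R
    & ratr (dam G k) / gamma <= ratr (density S)].

Variables (G : wgraph) (k : nat) (H : {set vertex G}).
Hypotheses (k_gt0 : (0 < k)%N) (Hk : #|H| = k) (H_gt0 : 0 < dweight H).
Implicit Types (S V : {set vertex G}) (L : seq {set vertex G}).

Let W (x : rat) : R := ratr x.

(** The two ways to stop, without divisions: a small union with half the weight of [H], or a larger
    one whose density is at least that of [H] divided by [2 * gamma]. *)
Definition good V : Prop :=
  (#|V| <= k)%N /\ W (dweight H) <= 2 * W (dweight V) \/
  [/\ (k <= #|V|)%N, #|V|%:R <= k%:R - 1 + beta * k%:R &
      #|V|%:R * W (dweight H) <= 2 * gamma * k%:R * W (dweight V)].

(** The third clause speaks of deleted weight, which adds up over rounds, instead of weight inside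
    the union. The last one charges each round to a deleted edge. *)
Definition going L : Prop :=
  [/\ (#|cov L| < k)%N, W (dweight H) <= 2 * W (subweight L H),
      #|cov L|%:R * W (dweight H) <=
        2 * gamma * k%:R * W (dweight [set: vertex G] - subweight L setT)
    & (nedges L + size L <= nedges (G := G) [::])%N].

Let k_gt0R : (0 : R) < k%:R. Proof. by rewrite ltr0n. Qed.
Let W_gt0 : 0 < W (dweight H). Proof. by rewrite /W ltr0q. Qed.
Let gamma_gt0 : 0 < gamma. Proof. exact: lt_le_trans gamma_ge1. Qed.

(** [H] has [k] vertices, so it competes in [dam (sub L) k] with the half of its weight that
    survives. *)
Lemma round_weight L S : @dam_post (sub L) k S ->
  W (dweight H) <= 2 * W (subweight L H) ->
  #|S|%:R * W (dweight H) <= 2 * gamma * k%:R * W (subweight L S).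
Proof.
move=> [S0 _ Sd] HL.
have S_gt0 : (0 : R) < #|S|%:R by rewrite ltr0n card_gt0.
have H0 : H != set0 by rewrite -card_gt0 Hk.
have : W (@density (sub L) H) / gamma <= W (@density (sub L) S).
  apply: le_trans Sd; rewrite ler_pM2r ?invr_gt0 // /W ler_rat.
  by apply: dam_ge; rewrite ?Hk.
rewrite !densityE -!/(subweight L _) Hk /W !fmorph_div !rmorphM /= !ratr_nat -!/(W _).
rewrite -[X in X <= _]mulrA -invfM ler_pdivrMr ?mulr_gt0 //.
rewrite mulrAC ler_pdivlMr ?mulr_gt0 // => h.
have {}h : #|S|%:R * W (subweight L H) <= gamma * k%:R * W (subweight L S).
  rewrite -(ler_pM2l (ltr0n R 2)).
  by apply: (ler_congr _ _ h); ring.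
apply: le_trans (ler_wpM2l (ltW S_gt0) HL) _.
by rewrite mulrCA -!mulrA ler_pM2l // mulrA.
Qed.

Lemma going_cons L S : going L -> @dam_post (sub L) k S ->
  good (cov (S :: L)) \/ going (S :: L).
Proof.
move=> [Lk LH Lw Le] pS; have Sw := round_weight pS LH.
have [S0 Sb _] := pS.
have S_gt0 : (0 : R) < #|S|%:R by rewrite ltr0n card_gt0.
have cU : (#|cov (S :: L)| <= #|cov L| + #|S|)%N by rewrite /= cardsU leq_subr.
(* The union gains at most [#|S|] vertices while the deleted weight gains exactly
   [subweight L S]. *)
have cUw : #|cov (S :: L)|%:R * W (dweight H) <= 2 * gamma * k%:R *
    W (dweight [set: vertex G] - subweight (S :: L) setT).
  apply: (@le_trans _ _ ((#|cov L|%:R + #|S|%:R) * W (dweight H))).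
    by rewrite ler_pM2r // -natrD ler_nat.
  rewrite subweight_cons setTI opprB addrCA addrC [W (_ + _)]rmorphD /= mulrDl.
  by rewrite [X in _ <= X]mulrDr lerD.
(* If the union just reached [k] vertices, at most [k - 1] were there before and [S] brought at most
   [beta * k]. *)
have [kU|Uk] := leqP k #|cov (S :: L)|.
  left; right; split => //.
    apply: (@le_trans _ _ (#|cov L|%:R + #|S|%:R)); first by rewrite -natrD ler_nat.
    by rewrite lerD // lerBrDr natr1 ler_nat.
  apply: le_trans cUw _; rewrite ler_pM2l ?mulr_gt0 //.
  by rewrite /W ler_rat subweight_removed.
(* If over half of the weight of [H] is gone, the missing part lies inside the union. *)
have [HU|HU] := leP (W (dweight H)) (2 * W (subweight (S :: L) H)); last first.
  left; left; split; first exact: ltnW.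
  have : W (dweight H) - W (subweight (S :: L) H) <= W (dweight (cov (S :: L))).
    by rewrite /W -rmorphB /= ler_rat subweight_removed.
  by move: HU; lra.
right; split => //=.
(* [S] is nonempty and [H] has positive weight, so the bound from [round_weight] is positive and an
   edge is deleted. *)
have /nedges_cons : 0 < subweight L S.
  have c0 : 0 < 2 * gamma * k%:R by rewrite !mulr_gt0.
  rewrite -(ltr0q R) -/(W _) -(pmulr_rgt0 _ c0).
  by apply: lt_le_trans Sw; rewrite mulr_gt0.
by move=> lt_e; apply: leq_trans Le; rewrite addnS -addSn leq_add2r.
Qed.

Lemma run_good L : (0 < nverts G)%N -> size L = (nverts G * nverts G)%N ->
  run dam_post k L -> exists2 V, V \in covs L & good V.
Proof.
move=> n0 sL rL.
(* After this many rounds, [going L] would contradict [nedges_lt]. *)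
suff [//|[_ _ _]] : (exists2 V, V \in covs L & good V) \/ going L.
  by have := nedges_lt n0; rewrite sL; lia.
elim: L rL {sL} => [_|S L IH [pS /IH{IH}[[V VL Vg]|gL]]].
- right; split; rewrite ?cards0 //=.
  + by rewrite subweight_nil; move: W_gt0; lra.
  + by rewrite mul0r subweight_nil subrr /W rmorph0 mulr0.
  + by rewrite addn0.
- by left; exists V => //=; rewrite inE VL orbT.
- have [gS|gS] := going_cons gL pS; [left|by right].
  by exists (cov (S :: L)); rewrite //= mem_head.
Qed.

Lemma good_resize V (T : {set vertex G}) : good V -> #|T| = k ->
  (if (#|V| <= k)%N then dweight V <= dweight T else
    dweight V * (k * k.-1)%:R <= dweight T * (#|V| * #|V|.-1)%:R) ->
  W (dweight H) <= 4 * (gamma ^+ 2 + gamma * beta) * W (dweight T).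
Proof.
move=> gV Tk VT; have WT0 : 0 <= W (dweight T) by rewrite /W ler0q dweight_ge0.
have gg : gamma <= gamma ^+ 2 by rewrite expr2 ler_peMl // ltW.
have gb : gamma <= gamma * beta by rewrite ler_peMr // ltW.
(* The cases yield the constants [2], [2 * gamma] and [2 * gamma * (1 + 2 * beta)], all below the
   target by [gg] and [gb]. *)
have le_of c : c <= 4 * (gamma ^+ 2 + gamma * beta) ->
    W (dweight H) <= c * W (dweight T) ->
    W (dweight H) <= 4 * (gamma ^+ 2 + gamma * beta) * W (dweight T).
  by move=> cC /le_trans; apply; rewrite ler_wpM2r.
case: gV => [[Vk Vw]|[kV Vb Vw]].
  rewrite Vk in VT; apply: (le_of 2); first by move: gamma_ge1 gg gb; lra.
  by apply: le_trans Vw _; rewrite ler_pM2l // /W ler_rat.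
case: leqP VT => [Vk VT|ltkV VT].
  have kE : #|V| = k by apply/eqP; rewrite eqn_leq Vk kV.
  apply: (le_of (2 * gamma)); first by move: gamma_ge1 gg gb; lra.
  rewrite -(ler_pM2l k_gt0R) -{1}kE; apply: le_trans Vw _.
  rewrite (mulrC _ k%:R) -!mulrA ler_pM2l // !ler_pM2l //.
  by rewrite /W ler_rat.
(* A single vertex carries no weight, so [k = 1] contradicts [H_gt0]; this allows cancelling
   [k - 1]. *)
have k2 : (1 < k)%N.
  rewrite ltnNge; apply/negP => k1.
  have /cards1P[v HE] : #|H| == 1%N by rewrite Hk eqn_leq k1 k_gt0.
  by move: H_gt0; rewrite HE /dweight !big_set1 wt_diag ltxx.
apply: (le_of (2 * gamma * (1 + 2 * beta))).
  by move: gamma_ge1 gg gb; rewrite mulrDr mulr1; lra.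
have {}VT : W (dweight V) * (k%:R * (k%:R - 1)) <=
    W (dweight T) * (#|V|%:R * (#|V|%:R - 1)).
  have predE m : (0 < m)%N -> m.-1%:R = m%:R - 1 :> R.
    by case: m => // m _; rewrite -natr1 addrK.
  rewrite -!predE ?(leq_trans k_gt0 kV) // -!natrM -!(ratr_nat R) /W -!rmorphM /=.
  by rewrite ler_rat.
have m_gt0 : (0 : R) < #|V|%:R by rewrite ltr0n (leq_trans k_gt0 kV).
have k1_gt0 : (0 : R) < k%:R - 1 by rewrite subr_gt0 ltr1n.
(* By [Vb] the left side is at most [k - 2 + beta * k], which falls short of the right side by
   [1 + beta * (k - 2)]. *)
have mb : #|V|%:R - 1 <= (k%:R - 1) * (1 + 2 * beta).
  have k2R : (2 : R) <= k%:R by rewrite ler_nat.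
  have : 0 <= beta * (k%:R - 2) by rewrite mulr_ge0 ?subr_ge0 // (le_trans _ beta_ge1).
  by move: Vb; lra.
(* |V| (k-1) W(H) <= 2 gamma k (k-1) W(V) <= 2 gamma |V| (|V|-1) W(T) *)
have h : W (dweight H) * (k%:R - 1) <= 2 * gamma * (W (dweight T) * (#|V|%:R - 1)).
  rewrite -(ler_pM2l m_gt0).
  apply: (@le_trans _ _ (2 * gamma * (W (dweight V) * (k%:R * (k%:R - 1))))).
    by apply: (ler_congr _ _ (ler_wpM2r (ltW k1_gt0) Vw)); ring.
  by apply: (ler_congr _ _ (ler_wpM2l (mulr_ge0 (ler0n R 2) (ltW gamma_gt0)) VT)); ring.
rewrite -(ler_pM2r k1_gt0); apply: le_trans h _.
have g0 : 0 <= 2 * gamma * W (dweight T) by rewrite mulr_ge0 // mulr_ge0 // ltW.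
by apply: (ler_congr _ _ (ler_wpM2l g0 mb)); ring.
Qed.

End Analysis.

Lemma dksP (R : realType) (beta gamma : R) (f : wmatrix * seq bool -> seq bool)
    (G : wgraph) k : 1 <= beta -> 1 <= gamma ->
  (forall (G : wgraph) k, (0 < nverts G)%N -> (0 < k)%N ->
    exists2 S : {set vertex G}, f (mat G, bits k) = vec S &
      dam_post beta gamma k S) ->
  (1 <= k <= nverts G)%N ->
  exists2 S : {set vertex G}, dks f (mat G, bits k) = vec S &
    #|S| = k /\
    ratr (dk G k) / (4 * (gamma ^+ 2 + gamma * beta)) <= ratr (density S).
Proof.
move=> hb hg hf /andP[k0 kn]; have n0 := leq_trans k0 kn.
have [L [sL rL lE]] := roundsP hf (fuel (mat G)) n0 k0.
rewrite size_fuel_mat in sL.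
have /choice[r rP] : forall V : {set vertex G}, exists T : {set vertex G},
    [/\ resize (mat G) (bits k) (vec V) = vec T, #|T| = k &
     if (#|V| <= k)%N then dweight V <= dweight T else
    dweight V * (k * k.-1)%:R <= dweight T * (#|V| * #|V|.-1)%:R].
  by move=> V; have [T ? []] := resizeP V kn; exists T.
have -> : dks f (mat G, bits k) = argbest (mat G) (map (@vec _) (map r (covs L))).
  rewrite /dks lE /= -!map_comp; congr argbest; apply: eq_map => V /=.
  by have [] := rP V.
have L0 : map r (covs L) != [::].
  by case: (L) sL => //= s0; have := n0; nia.
have [S /mapP[V _ SE] [-> Smax]] := argbest_max L0.
have Sk : #|S| = k by rewrite SE; have [] := rP V.
exists S => //; split => //.
have C0 : 0 < 4 * (gamma ^+ 2 + gamma * beta).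
  rewrite mulr_gt0 // addr_gt0 // ?exprn_gt0 ?mulr_gt0 //; try exact: lt_le_trans hg.
  exact: lt_le_trans hb.
have d0 (X : {set vertex G}) : 0 <= density X.
  by rewrite densityE divr_ge0 ?dweight_ge0 // mulr_ge0.
have [->|[H Hk ->]] := dk_attained G k.
  by rewrite rmorph0 mul0r ler0q d0.
rewrite ler_pdivrMr //.
(* The analysis of the rounds supposes positive weight; a weightless optimum is matched by any
   set. *)
have [H0|H_gt0] := leP (dweight H) 0.
  have -> : density H = 0.
    have HE : dweight H = 0 by apply/eqP; rewrite eq_le H0 dweight_ge0.
    by rewrite densityE HE mul0r.
  by rewrite rmorph0 mulr_ge0 ?ler0q ?d0 // ltW.
have [V' V'L V'g] := run_good hb hg k0 Hk H_gt0 n0 sL rL.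
have [_ rk rw] := rP V'.
have := good_resize hb hg k0 Hk H_gt0 V'g rk rw => HT.
have {}HT : ratr (dweight H) <= 4 * (gamma ^+ 2 + gamma * beta) * ratr (dweight S).
  apply: le_trans HT _; rewrite ler_pM2l // ler_rat Smax //.
  exact: map_f.
rewrite !densityE Hk Sk !fmorph_div /= [X in _ <= X]mulrAC ler_pM2r.
  by rewrite [X in _ <= X]mulrC.
by rewrite invr_gt0 ltr0q mulr_gt0 // ltr0n.
Qed.

(** * From programs to functions on lists and back *)

Lemma encode_bits_inj : injective (encode : seq bool -> tree).
Proof.
by elim=> [|b s IH] [|c t] //= [bc /IH ->]; case: b c bc => [] [].
Qed.

Lemma encode_instance G k : encode (mat G, bits k) = enc_instance G k.
Proof.
rewrite /enc_instance /enc_graph; congr Cons; rewrite /= /mat -map_comp.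
congr enc_seq; apply: eq_map => i /=; rewrite -map_comp; congr enc_seq.
by apply: eq_map => j /=; case: edge.
Qed.

Lemma encode_vec G (S : {set vertex G}) : encode (vec S) = enc_set S.
Proof. by rewrite /= /vec -map_comp. Qed.

(** The function is obtained by choice from the runs of [A]. Determinism and injectivity of the
    encoding show that its values are the sets promised by [post]. *)
Lemma polytime_alg_fun (A : cmd)
    (post : forall G : wgraph, nat -> {set vertex G} -> Prop) :
  polytime_alg A (fun G k => (0 < nverts G)%N /\ (0 < k)%N) post ->
  exists2 f : wmatrix * seq bool -> seq bool, ptime call_dom f &
    forall (G : wgraph) k, (0 < nverts G)%N -> (0 < k)%N ->
      exists2 S : {set vertex G}, f (mat G, bits k) = vec S & post G k S.
Proof.
move=> [a [d hA]].
have /choice[f fP] : forall z, exists o : seq bool, call_dom z ->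
    exists t s, exec A (init (encode z)) t s /\ s 0%N = encode o.
  move=> z; have [[G [k [n0 k0 zE]]]|] := pselect (call_dom z); last by exists [::].
  have [t [s [S [e _ sE _]]]] := hA G k (conj n0 k0).
  by exists (vec S) => _; exists t, s; rewrite zE encode_instance sE encode_vec.
exists f.
  have [c hc] : poly_bounded (fun n => a * (n + 2) ^ d + a)%N by poly_bounded_tac.
  exists A, c => z /[dup] zd [G [k [n0 k0 zE]]].
  have [t [s [S [e ht sE _]]]] := hA G k (conj n0 k0).
  have [t' [s' [e' s'E]]] := fP z zd.
  rewrite zE encode_instance in e'.
  exists t, s; rewrite zE /esize encode_instance; split => //.
    apply: leq_trans ht _; apply: leq_trans (hc _).
    rewrite leq_add2r leq_mul2l; apply/orP; right.
    by case: (d) => // d'; rewrite leq_exp2r // leq_addr.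
  by rewrite -zE -s'E (exec_deterministic e' e).
move=> G k n0 k0; have [t [s [S [e _ sE pS]]]] := hA G k (conj n0 k0).
exists S => //; have [|t' [s' [e' s'E]]] := fP (mat G, bits k).
  by exists G, k.
apply: encode_bits_inj; rewrite -s'E encode_vec -sE.
by rewrite encode_instance in e'; rewrite (exec_deterministic e e').
Qed.

Theorem theorem4 (R : realType) (beta gamma : R)
    (hbeta : 1 <= beta) (hgamma : 1 <= gamma)
    (hA : exists A : cmd,
      polytime_alg A
        (fun (G : wgraph) (k : nat) => (0 < nverts G)%N /\ (0 < k)%N)
        (fun (G : wgraph) (k : nat) (S : {set vertex G}) =>
          [/\ S != set0,
              #|S|%:R <= beta * k%:R
            & ratr (dam G k) / gamma <= ratr (density S)])) :
  exists B : cmd,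
    polytime_alg B
      (fun (G : wgraph) (k : nat) => (1 <= k <= nverts G)%N)
      (fun (G : wgraph) (k : nat) (S : {set vertex G}) =>
        #|S| = k /\
        ratr (dk G k) / (4 * (gamma ^+ 2 + gamma * beta)) <= ratr (density S)).
Proof.
have [A /polytime_alg_fun[f hf fP]] := hA.
have [B [c hB]] := ptime_dks fP hf.
(* An instance has size [n >= 1], so [(n + 2) ^ c] is at most [3 ^ c * n ^ c]. *)
exists B, (3 ^ c)%N, c => G k kn.
have [|t [s [e ht sE]]] := hB (mat G, bits k); first by exists G, k.
have [S SE HS] := dksP hbeta hgamma fP kn.
exists t, s, S; split => //.
- by rewrite -encode_instance.
- apply: leq_trans ht _; rewrite /esize encode_instance.
  apply: leq_trans (leq_addr _ _); rewrite -expnMn.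
  have := tree_size_gt0 (enc_instance G k); case: (c) => // c'.
  by rewrite leq_exp2r //; lia.
- by rewrite sE SE encode_vec.
Qed.
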